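(* For all $A,B\in\mathfrak{J}_n$ and $s,t\in\mathbb{R}$ the measure average satisfies: (1) (closure) $tA\oplus(1-t)B\in\mathfrak{J}_n$; (2) (interpolation) $0A\oplus1B=B$ and $1A\oplus0B=A$; (3) (submetric) $d_\mu\big(sA\oplus(1-s)B,\ tA\oplus(1-t)B\big)\le|t-s|\,d_\mu(A,B)$; and moreover for $s,t\in[0,1]$: (4) (measure) $\mu\big(tA\oplus(1-t)B\big)=t\mu(A)+(1-t)\mu(B)$; (5) (metric) $d_\mu\big(sA\oplus(1-s)B,\ tA\oplus(1-t)B\big)=|t-s|\,d_\mu(A,B)$; (6) (inclusion) $\operatorname{ci}(A\cap B)\subseteq tA\oplus(1-t)B\subseteq A\cup B$.
   Context: Notation: $\mu$ is $n$-dimensional Lebesgue measure; $\operatorname{ci}(E)$ is the closure of the interior of $E$; $\mathfrak{J}_n$ is the family of bounded sets $A\subset\mathbb{R}^n$ with $A=\operatorname{ci}(A)$ and $\mu(\partial A)=0$ (the empty set included); $d_\mu(A,B)=\mu(A\triangle B)$ (a metric on $\mathfrak{J}_n$). For nonempty bounded $A$: $d_S(p,A)=d(p,\partial A)$ if $p\in A$, $-d(p,\partial A)$ if $p\notin A$, where $d(q,E)=\min_{e\in E}\|q-e\|$. $O(B,r)=\{p:d(p,B)\le r\}$ for $r\ge0$. Distance average: for nonempty $A,B\in\mathfrak{J}_n$, $x\in\mathbb{R}$, $xA\,\widetilde\oplus\,(1-x)B=\{p: x d_S(p,A)+(1-x)d_S(p,B)\ge0\}$; if $A\ne\emptyset=B$,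 fix $q\in A$ maximizing $d_S(\cdot,A)$ over $A$ and set $xA\,\widetilde\oplus\,(1-x)B=\{p: x d_S(p,A)+(x-1)\|p-q\|\ge0\}$; the distance average of two empty sets is $\emptyset$. Let $h_{A,B}(x)=\mu(xA\,\widetilde\oplus\,(1-x)B)$. $A,B$ satisfy the zero-measure condition if $\mu(\{p: \tfrac12 d_S(p,A)+\tfrac12 d_S(p,B)=0\})=0$. Measure average $tA\oplus(1-t)B$ ($t\in\mathbb{R}$), defined in three steps (a fixed large number $N>0$ and, where needed, a fixed $\varepsilon>0$ are chosen once). Always $tA\oplus(1-t)A=A$. Step 1 (simply different: $B\subsetneq A$, $A\setminus B$ connected). If $A,B$ satisfy the zero-measure condition, or if $t\notin[0,1]$: $tA\oplus(1-t)B=\operatorname{ci}\big(gA\,\widetilde\oplus\,(1-g)B\big)$ where $g\in[-N,N]$ is any point attaining $\inf_{\xi\in[-N,N]}|h_{A,B}(\xi)-(t\mu(A)+(1-t)\mu(B))|$ (the set obtained does not depend on this choice). If the zero-measure condition fails and $t\in[0,1]$: $tA\oplus(1-t)B=\operatorname{ci}(O(B,r)\cap A)$ for any $r\ge0$ with $\mu(O(B,r)\cap A)=t\mu(A)+(1-t)\mu(B)$. Step 2 (nested: $B\subsetneq A$). If $A\setminus B$ has finitely many connected components, for each component $C$ let $R_{C,t}=t(B\cup C)\oplus(1-t)B$ (Step 1), and set $tA\oplus(1-t)B=\bigcup_C R_{C,t}$ for $t\ge0$ and $\operatorname{ci}\big(\bigcap_C R_{C,t}\big)$ for $t<0$. If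 there are infinitely many components, all components of measure $<\varepsilon$ are merged into one set $U$, which is treated as a single component in these formulas. Step 3 (general $A,B$). Let $I=\operatorname{ci}(A\cap B)$, $R_{1,t}=tA\oplus(1-t)I$ and $R_{2,t}=(1-t)B\oplus tI$ (Step 2 averages of nested pairs, weight first on the larger set). Then $tA\oplus(1-t)B=R_{1,t}\cup R_{2,t}$ for $t\in[0,1]$; $=\operatorname{ci}(R_{1,t}\setminus(A\cap B))\cup R_{2,t}$ for $t>1$; and for $t<0$ it is defined as $(1-t)B\oplus tA$, computed by the $t>1$ rule with the roles of $A$ and $B$ exchanged (parameter $1-t>1$). *)

(* Defs.v *)
From HB Require Import structures.
From mathcomp Require Import all_boot all_order all_algebra.
From mathcomp Require Import all_classical all_reals all_analysis.
Set Implicit Arguments. Unset Strict Implicit. Unset Printing Implicit Defensive.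
Import Order.TTheory GRing.Theory Num.Theory.
Import numFieldNormedType.Exports.
Local Open Scope classical_set_scope.
Local Open Scope ring_scope.

(* Points of R^n are row vectors 'rV[R]_n (product topology = Euclidean topology). *)
Notation pt R n := ('rV[R]_n).

Definition enorm (R : realType) (n : nat) (p : pt R n) : R :=
  Num.sqrt (\sum_(i < n) p ord0 i ^+ 2).

(* d(q,E) = min_{e in E} |q - e| (written as an infimum; it is attained for
   closed nonempty E) *)
Definition dist (R : realType) (n : nat) (q : pt R n) (E : set (pt R n)) : R :=
  inf [set enorm (q - e) | e in E].

Definition ci (R : realType) (n : nat) (E : set (pt R n)) : set (pt R n) :=
  closure (interior E).

Definition bdry (R : realType) (n : nat) (E : set (pt R n)) : set (pt R n) :=
  closure E `\` interior E.

Definition box (R : realType) (n : nat) (a b : pt R n) : set (pt R n) :=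
  [set p | forall i : 'I_n, a ord0 i <= p ord0 i <= b ord0 i].

Definition boxvol (R : realType) (n : nat) (a b : pt R n) : R :=
  \prod_(i < n) Num.max (b ord0 i - a ord0 i) 0.

Definition leb_outer (R : realType) (n : nat) (E : set (pt R n)) : \bar R :=
  ereal_inf [set x | exists a b : nat -> pt R n,
     E `<=` \bigcup_k box (a k) (b k) /\
     x = (\sum_(k <oo) (boxvol (a k) (b k))%:E)%E].

(* mu : real-valued (all sets considered are bounded, hence of finite measure) *)
Definition mu (R : realType) (n : nat) (E : set (pt R n)) : R := fine (leb_outer E).

Definition dmu (R : realType) (n : nat) (A B : set (pt R n)) : R :=
  mu ((A `\` B) `|` (B `\` A)).

Definition bounded_set (R : realType) (n : nat) (A : set (pt R n)) : Prop :=
  exists M : R, forall p, A p -> enorm p <= M.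

Definition Jn (R : realType) (n : nat) (A : set (pt R n)) : Prop :=
  bounded_set A /\ A = ci A /\ mu (bdry A) = 0.

Definition dS (R : realType) (n : nat) (p : pt R n) (A : set (pt R n)) : R :=
  if `[< A p >] then dist p (bdry A) else - dist p (bdry A).

Definition Onbhd (R : realType) (n : nat) (B : set (pt R n)) (r : R) : set (pt R n) :=
  [set p | dist p B <= r].

(* A choice of centre q in A maximizing d_S(.,A) over A ("fix q"), made
   whenever such a maximizer exists; the theorem is stated for every such
   selector. *)
Definition centre_selector (R : realType) (n : nat) (qs : set (pt R n) -> pt R n) : Prop :=
  forall A : set (pt R n),
    (exists q, A q /\ forall p, A p -> dS p A <= dS q A) ->
    A (qs A) /\ forall p, A p -> dS p A <= dS (qs A) A.

(* The function whose nonnegativity set is the distance average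
   xA (+~) (1-x)B. For B empty (A nonempty) it is x d_S(p,A) + (x-1)|p-q|;
   the (unused) symmetric case A empty, B nonempty is treated symmetrically. *)
Definition dfun (R : realType) (n : nat) (qs : set (pt R n) -> pt R n)
  (x : R) (A B : set (pt R n)) (p : pt R n) : R :=
  if `[< A !=set0 >] then
    if `[< B !=set0 >] then x * dS p A + (1 - x) * dS p B
    else x * dS p A + (x - 1) * enorm (p - qs A)
  else
    if `[< B !=set0 >] then (1 - x) * dS p B + (- x) * enorm (p - qs B)
    else -1.

Definition davg (R : realType) (n : nat) (qs : set (pt R n) -> pt R n)
  (x : R) (A B : set (pt R n)) : set (pt R n) :=
  [set p | 0 <= dfun qs x A B p].

Definition hAB (R : realType) (n : nat) (qs : set (pt R n) -> pt R n)
  (A B : set (pt R n)) (x : R) : R := mu (davg qs x A B).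

Definition zero_measure_cond (R : realType) (n : nat) (qs : set (pt R n) -> pt R n)
  (A B : set (pt R n)) : Prop :=
  mu [set p | dfun qs (2^-1) A B p = 0] = 0.

Definition step1 (R : realType) (n : nat) (qs : set (pt R n) -> pt R n) (N : R)
  (t : R) (A B : set (pt R n)) : set (pt R n) :=
  let target := t * mu A + (1 - t) * mu B in
  if `[< zero_measure_cond qs A B \/ ~ (0 <= t <= 1) >] then
    let g := get (fun g : R => -N <= g <= N /\
               forall xi : R, -N <= xi <= N ->
                 `|hAB qs A B g - target| <= `|hAB qs A B xi - target|) in
    ci (davg qs g A B)
  else
    let r := get (fun r : R => 0 <= r /\ mu (Onbhd B r `&` A) = target) in
    ci (Onbhd B r `&` A).

Definition components (R : realType) (n : nat) (S : set (pt R n)) : set (set (pt R n)) :=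
  [set connected_component S x | x in S].

Definition step2_family (R : realType) (n : nat) (eps : R) (A B : set (pt R n))
  : set (set (pt R n)) :=
  let Cs := components (A `\` B) in
  if `[< finite_set Cs >] then Cs
  else [set C | Cs C /\ eps <= mu C] `|`
       [set \bigcup_(C in [set C | Cs C /\ mu C < eps]) C].

(* ---------- Step 2 (nested B subset A) ---------- *)
Definition step2 (R : realType) (n : nat) (qs : set (pt R n) -> pt R n) (N eps : R)
  (t : R) (A B : set (pt R n)) : set (pt R n) :=
  if `[< A = B >] then A else
  let F := step2_family eps A B in
  let RC := fun C => step1 qs N t (B `|` C) B in
  if 0 <= t then [set p | exists2 C, F C & RC C p]
  else ci [set p | forall C, F C -> RC C p].

Definition mavg (R : realType) (n : nat) (qs : set (pt R n) -> pt R n) (N eps : R)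
  (t : R) (A B : set (pt R n)) : set (pt R n) :=
  if `[< A = B >] then A else
  let I := ci (A `&` B) in
  let R1 := fun u => step2 qs N eps u A I in
  let R2 := fun u => step2 qs N eps u B I in
  if 0 <= t <= 1 then R1 t `|` R2 (1 - t)
  else if 1 < t then ci (R1 t `\` (A `&` B)) `|` R2 (1 - t)
  else ci (R2 (1 - t) `\` (B `&` A)) `|` R1 t.

(* Main.v *)
(* For a nested pair B in V put D_x = {x d_S(.,V) + (1-x) d_S(.,B) >= 0} and h(x) = mu(D_x).  Since d_S(.,B) <= d_S(.,V), the sets D_x increase with x.  For x <> 1/2 the level set {x d_S(.,V) + (1-x) d_S(.,B) = 0} is null because it is porous: one of the two terms has the larger coefficient, and moving towards the nearest boundary point of the corresponding set changes it at full speed, faster than the other term can compensate.  Porosity gives measure zero by subdividing cubes, so Lebesgue's density theorem and Rademacher's theorem are not needed.  Hence h is continuous away from 1/2, the minimizers in Step 1 exist, and the measure of the Step 1 average is the target t mu(V) + (1-t) mu(B) clamped to [h(-N), h(N)]; as the averages increase with t, they are |t-s| mu(V \ B)-close in d_mu.  If B is empty the level set at 1/2 is null as well, so the neighbourhoods O(B,r) are only used for nonempty B.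

Steps 2 and 3 only combine such families by finite unions, intersections and differences, under which d_mu is subadditive; this gives the submetric property.  The measure and metric properties on [0,1] then follow because the endpoints are fixed: the triangle inequality from 0 to 1 through s and t is tight. *)

Require Import Defs.
From HB Require Import structures.
From mathcomp Require Import all_boot all_order all_algebra.
From mathcomp Require Import all_classical all_reals all_analysis.
From mathcomp Require Import measurable_realfun ring lra.
Import Order.TTheory GRing.Theory Num.Theory.
Import numFieldNormedType.Exports.
Local Open Scope classical_set_scope.
Local Open Scope ring_scope.

Set Implicit Arguments. Unset Strict Implicit. Unset Printing Implicit Defensive.
Local Notation bounded_set := Defs.bounded_set.
Local Notation davg := Defs.davg.

(** * Lebesgue outer measure *)

(** The [get] in Step 1 returns an unknown minimizer, so the argument compares measures instead of
    parameters: the sets D_x are closed and nested, and two of them with equal measure have the same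
    [ci], because a nonempty open set has positive measure. A convenient minimizer can thus replace
    the one returned. When the level set at 1/2 is not null, distance averages occur only for t
    outside [0,1]; the target is then at most h(0) or at least h(1), and a minimizer is found in
    [-N,0] or [1,N], away from 1/2. The bound [1 <= N] puts 0 and 1 into [-N,N], which makes the
    clamping invisible for t in [0,1].

    The sets V made of B and a component need not be closed, and the merged set U may consist of
    infinitely many components. One observation handles both: a ball inside A \ B lies in a single
    component, so a union of any components has no boundary points beyond those forced by the
    boundaries of A and B. *)

Section outer_lebesgue.
Variables (R : realType) (n : nat).
Local Notation E := 'rV[R]_n.+1.
Local Notation leb := (@leb_outer R n.+1).
Implicit Types (a b p q : E) (A B X : set E).

Lemma boxvol_ge0 a b : 0 <= boxvol a b.
Proof. by apply: prodr_ge0 => i _; rewrite le_max lexx orbT. Qed.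

(** Degenerate boxes pad a finite cover to a sequence. In dimension 0 the empty product would be 1,
    hence the index [n.+1]. *)
Lemma boxvol00 : boxvol (0 : E) 0 = 0.
Proof. by rewrite /boxvol (bigD1 ord0)//= subrr maxxx mul0r. Qed.

Lemma leb_outer_cover X (a b : nat -> E) : X `<=` \bigcup_k box (a k) (b k) ->
  (leb X <= \sum_(k <oo) (boxvol (a k) (b k))%:E)%E.
Proof. by move=> Xab; apply: ereal_inf_lbound; exists a, b. Qed.

Lemma leb_outer_ge0 X : (0 <= leb X)%E.
Proof.
apply: le_ereal_inf_tmp => _ [a [b [_ ->]]].
by apply: nneseries_ge0 => k _ _; rewrite lee_fin boxvol_ge0.
Qed.

Lemma leb_outer_box a b : (leb (box a b) <= (boxvol a b)%:E)%E.
Proof.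
pose f (c : E) k : E := if k is 0%N then c else 0.
apply: (le_trans (@leb_outer_cover _ (f a) (f b) _)).
  by move=> p pab; exists 0%N.
rewrite nneseries_recl//=; last by move=> *; rewrite lee_fin boxvol_ge0.
rewrite eseries_cond/= eseries0 ?adde0// => -[|k]//= _ _.
by rewrite boxvol00.
Qed.

Lemma leb_outer_set0 : leb set0 = 0%E.
Proof.
apply/eqP; rewrite eq_le leb_outer_ge0 andbT.
apply: (le_trans (@leb_outer_cover _ (fun=> 0) (fun=> 0) _)) => //.
by rewrite eseries0// => k _ _; rewrite boxvol00.
Qed.

Lemma le_leb_outer : {homo leb : A B / A `<=` B >-> (A <= B)%E}.
Proof.
move=> A B AB; apply: le_ereal_inf => _ [a [b [Bab ->]]].
by exists a, b; split => //; exact: subset_trans Bab.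
Qed.

(** Each [A k] is covered with an excess of at most e / 2^(k+1), and the doubly indexed boxes are
    listed along a bijection of nat with pairs; the excesses sum to e. *)
Lemma leb_outer_sigma_subadditive : sigma_subadditive leb.
Proof.
move=> A; have [[i ioo]|] := pselect (exists i, leb (A i) = +oo%E).
  rewrite (eseries_pinfty _ _ ioo) ?leey// => k _.
  by rewrite -ltNye (lt_le_trans _ (leb_outer_ge0 _)).
rewrite -forallNE => Aoo.
suff add2e (e : {posnum R}) :
    (leb (\bigcup_n A n) <= \sum_(i <oo) leb (A i) + e%:num%:E)%E.
  by apply/lee_addgt0Pr => _/posnumP[].
rewrite (le_trans _ (epsilon_trick _ _ _))//; last first.
  by move=> k; exact: leb_outer_ge0.
pose V (ab : E * E) : \bar R := (boxvol ab.1 ab.2)%:E.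
have V0 ab : (0 <= V ab)%E by rewrite lee_fin boxvol_ge0.
pose P k (B : nat -> E * E) := A k `<=` \bigcup_j box (B j).1 (B j).2 /\
  (\sum_(j <oo) V (B j) <= leb (A k) + (e%:num / (2 ^ k.+1)%:R)%:E)%E.
have [G PG] : {G : nat -> nat -> E * E & forall k, P k (G k)}.
  apply: (@choice _ _ P) => k; rewrite /P /leb_outer.
  set S := (X in ereal_inf X); move infS : (ereal_inf S) => iS.
  case: iS infS => [r Sr|Soo|Soo].
  - have en1 : (0 < e%:num / (2 ^ k.+1)%:R)%R by [].
    have /(lb_ereal_inf_adherent en1) : ereal_inf S \is a fin_num by rewrite Sr.
    move=> [x [a [b [Aab xE]] xS]].
    exists (fun j => (a j, b j)); split => //.
    by rewrite -Sr; apply/ltW; rewrite xE in xS.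
  - by have := Aoo k; rewrite /leb_outer Soo.
  - have := leb_outer_ge0 (A k); rewrite /leb_outer.
    by rewrite -/S Soo.
have muG_ge0 x : (0 <= (V \o uncurry G) x)%E by exact: V0.
apply: (@le_trans _ _ (\esum_(i in setT) (V \o uncurry G) i)%E).
  apply: ereal_inf_lbound => /=.
  have /card_esym/ppcard_eqP[f] := card_nat2.
  exists (fun k => (uncurry G (f k)).1), (fun k => (uncurry G (f k)).2); split.
    move=> t [i _ /(PG i).1[j _ Gt]].
    by exists (f^-1%FUN (i, j)) => //=; rewrite invK ?inE.
  transitivity (\sum_(k <oo) (V \o uncurry G) (f k))%E => //.
  rewrite -(esum_pred_image (V \o uncurry G) _ xpredT) ?[fun=> _]set_true//.
  congr (esum _ _); apply/seteqP; split => // x _.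
  by exists (f^-1%FUN x) => //; rewrite invK ?inE.
rewrite (_ : esum _ _ = \sum_(i <oo) \sum_(j <oo ) V (G i j))%E; last first.
  pose J : nat -> set (nat * nat) := fun i => [set (i, j) | j in setT].
  rewrite (_ : setT = \bigcup_k J k); last first.
    by rewrite predeqE => -[a b]; split => // _; exists a => //; exists b.
  rewrite esum_bigcupT /=; last 2 first.
    - apply/trivIsetP => i j _ _ ij.
      rewrite predeqE => -[k m] /=; split => //= -[] [_] _ [<-{k} _].
      by move=> [m' _] [] /esym/eqP; rewrite (negbTE ij).
    - by move=> /= [k m].
  rewrite -(image_id [set: nat]) -fun_true esum_pred_image//; last first.
    by move=> k _; exact: esum_ge0.
  apply: eq_eseriesr => /= j _.
  rewrite -(esum_pred_image (V \o uncurry G) (pair j) predT)//=; last first.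
    by move=> ? ? _ _; exact: (@can_inj _ _ _ snd).
  by congr esum; rewrite predeqE => -[a b]; split; move=> [i _ <-]; exists i.
apply: lee_lim.
- apply: is_cvg_nneseries => k *.
  by apply: nneseries_ge0 => m *; exact: (muG_ge0 (k, m)).
- apply: is_cvg_nneseries => k *; apply: adde_ge0 => //; exact: leb_outer_ge0.
- by near=> m; apply: lee_sum => i _; exact: (PG i).2.
Unshelve. all: by end_near. Qed.

HB.instance Definition _ := isOuterMeasure.Build R E leb
  leb_outer_set0 leb_outer_ge0 le_leb_outer leb_outer_sigma_subadditive.

End outer_lebesgue.

(** * Measurability of half-spaces and the outer measure of boxes *)

Section boxes.
Variables (R : realType) (n : nat).
Local Notation E := 'rV[R]_n.+1.
Local Notation leb := (@leb_outer R n.+1).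
Implicit Types (a b p q : E) (A B X : set E).

(** The hyperplane replaces side [i] by two sides whose positive parts add up to that of the
    original; clipping with min and max also covers empty boxes and hyperplanes that miss the
    box. *)
Lemma boxvol_split (i : 'I_n.+1) (c : R) a b :
  boxvol a (\row_j if j == i then Num.min (b ord0 j) c else b ord0 j) +
  boxvol (\row_j if j == i then Num.max (a ord0 j) c else a ord0 j) b =
  boxvol a b.
Proof.
rewrite /boxvol (bigD1 i)//= [X in _ + X = _](bigD1 i)//= [RHS](bigD1 i)//= !mxE eqxx.
rewrite (eq_bigr (fun j => Num.max (b ord0 j - a ord0 j) 0)); last first.
  by move=> j ji; rewrite mxE (negbTE ji).
rewrite [X in _ + _ * X](eq_bigr (fun j => Num.max (b ord0 j - a ord0 j) 0)); last first.
  by move=> j ji; rewrite mxE (negbTE ji).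
rewrite -mulrDl; congr (_ * _).
set u := a _ _; set v := b _ _.
have [vc|cv] := leP v c; have [uc|cu] := leP u c; rewrite /Num.max;
  by repeat (case: ltP => ?); lra.
Qed.

(** Clipping every box of a cover at the hyperplane yields covers of both halves without changing
    the total volume. *)
Lemma caratheodory_halfspace (i : 'I_n.+1) (c : R) :
  leb.-caratheodory [set p : E | p ord0 i <= c].
Proof.
apply: le_caratheodory_measurable => X.
apply: le_ereal_inf_tmp => _ [a [b [Xab ->]]].
pose b' k : E := \row_j if j == i then Num.min (b k ord0 j) c else b k ord0 j.
pose a' k : E := \row_j if j == i then Num.max (a k ord0 j) c else a k ord0 j.
apply: (@le_trans _ _ (\sum_(k <oo) (boxvol (a k) (b' k))%:E +
                      \sum_(k <oo) (boxvol (a' k) (b k))%:E)%E).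
  apply: leeD; apply: leb_outer_cover => p [/Xab[k _ pab] /= pc].
    exists k => // j; rewrite mxE; have /andP[ap pb] := pab j.
    case: ifPn => [/eqP ->|_]; last by rewrite ap pb.
    by rewrite le_min (andP (pab i)).1 (andP (pab i)).2 pc.
  exists k => // j; rewrite mxE; have /andP[ap pb] := pab j.
  case: ifPn => [/eqP ->|_]; last by rewrite ap pb.
  move/negP: pc; rewrite -ltNge => pc.
  by rewrite ge_max (andP (pab i)).1 (andP (pab i)).2 (ltW pc).
rewrite -nneseriesD; last 2 first.
- by move=> *; rewrite lee_fin boxvol_ge0.
- by move=> *; rewrite lee_fin boxvol_ge0.
rewrite le_eqVlt; apply/orP; left; apply/eqP; apply: eq_eseriesr => k _.
by rewrite -EFinD boxvol_split.
Qed.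

(** Interpolates between the indicator of the box (j = 0) and its volume (j = n + 1): coordinates
    below [j] have been integrated out, the others are still evaluated at [x]. *)
Let W (j : nat) (a b : E) (x : 'I_n.+1 -> R) : R :=
  \prod_(i < n.+1) (if (i < j)%N then Num.max (b ord0 i - a ord0 i) 0
                    else \1_(`[a ord0 i, b ord0 i]) (x i)).

Let W_ge0 j a b x : 0 <= W j a b x.
Proof.
apply: prodr_ge0 => i _; case: ifPn => _; first by rewrite le_max lexx orbT.
by rewrite indicE.
Qed.

Let upd (x : 'I_n.+1 -> R) i0 y := fun i => if i == i0 then y else x i.

Let W_upd (i0 : 'I_n.+1) a b x y :
  W i0 a b (upd x i0 y) =
  (\prod_(i < n.+1 | i != i0) (if (i < i0)%N then Num.max (b ord0 i - a ord0 i) 0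
      else \1_(`[a ord0 i, b ord0 i]) (x i))) * \1_(`[a ord0 i0, b ord0 i0]) y.
Proof.
rewrite /W (bigD1 i0)//= ltnn /upd eqxx mulrC; congr (_ * _).
by apply: eq_bigr => i /negbTE ->.
Qed.

Let W_succ (i0 : 'I_n.+1) a b x :
  W i0.+1 a b x =
  (\prod_(i < n.+1 | i != i0) (if (i < i0)%N then Num.max (b ord0 i - a ord0 i) 0
      else \1_(`[a ord0 i, b ord0 i]) (x i))) * Num.max (b ord0 i0 - a ord0 i0) 0.
Proof.
rewrite /W (bigD1 i0)//= ltnSn mulrC; congr (_ * _).
apply: eq_bigr => i ii0; rewrite ltnS leq_eqVlt.
by rewrite (negbTE (_ : val i != val i0)).
Qed.

Let measurable_W (i0 : 'I_n.+1) a b x :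
  measurable_fun setT (fun y => (W i0 a b (upd x i0 y))%:E).
Proof.
under eq_fun do rewrite W_upd.
by apply/measurable_EFinP; apply: measurable_funM.
Qed.

Let integral_W (i0 : 'I_n.+1) a b x :
  (\int[lebesgue_measure]_y (W i0 a b (upd x i0 y))%:E = (W i0.+1 a b x)%:E)%E.
Proof.
under eq_integral do rewrite W_upd EFinM.
rewrite ge0_integralZl_EFin//; last 2 first.
- exact/measurable_EFinP.
- apply: prodr_ge0 => i _; case: ifPn => _; first by rewrite le_max lexx orbT.
  by rewrite indicE.
rewrite integral_indic// setIT W_succ EFinM; congr (_ * _)%E.
apply: etrans (lebesgue_measure_itv `[a ord0 i0, b ord0 i0]) _.
rewrite /= lte_fin -EFinB /Num.max subr_lt0.
by case: ltgtP => // e; rewrite e subrr.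
Qed.

(* Integrating out one coordinate at a time turns the pointwise inequality between indicators of boxes into the inequality between their volumes. *)
Lemma boxvol_le_leb_outer a b : ((boxvol a b)%:E <= leb (box a b))%E.
Proof.
apply: le_ereal_inf_tmp => _ [aa [bb [cov ->]]].
have key j : (j <= n.+1)%N -> forall x,
    ((W j a b x)%:E <= \sum_(k <oo) (W j (aa k) (bb k) x)%:E)%E.
  elim: j => [_ x|j IH jn x].
    have [xab|xab] := pselect (box a b (\row_i x i)).
      (* One covering box that contains the point already contributes 1 to the series. *)
      have [k _ xk] := cov _ xab.
      rewrite (nneseries_split _ k.+1)//; last by move=> *; rewrite lee_fin.
      rewrite big_mkord big_ord_recr/=.
      apply: (@le_trans _ _ (W 0 (aa k) (bb k) x)%:E).
        rewrite lee_fin /W /=.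
        rewrite [leRHS]big1; last first.
          move=> i _; rewrite indicE; have := xk i; rewrite mxE => xi.
          by rewrite mem_set//= in_itv.
        apply: prodr_ile1 => i _; rewrite indicE; case: (_ \in _); by rewrite ?lexx ?ler01.
      apply: (@le_trans _ _ (\sum_(i < k) (W 0 (aa i) (bb i) x)%:E +
                            (W 0 (aa k) (bb k) x)%:E)%E).
        by apply: leeDr; apply: sume_ge0 => *; rewrite lee_fin.
      by apply: leeDl; apply: nneseries_ge0 => *; rewrite lee_fin.
    have [i xi] : exists i, ~ (a ord0 i <= x i <= b ord0 i).
      by apply: contrapT => h; apply: xab => i; rewrite mxE; apply: contrapT => h'; apply: h; exists i.
    rewrite /W /= (bigD1 i)//= indicE memNset ?mul0r; last by rewrite /= in_itv.
    by apply: nneseries_ge0 => k _ _; rewrite lee_fin; exact: (W_ge0 0).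
  (* Both sides for [j.+1] are integrals over coordinate [j] of the sides for [j], once the integral
     is exchanged with the series of nonnegative terms. *)
  pose i0 : 'I_n.+1 := Ordinal jn.
  rewrite -[j]/(val i0) -integral_W.
  under eq_eseriesr do rewrite -integral_W.
  rewrite -integral_nneseries//; last first.
    by move=> *; rewrite lee_fin.
    by move=> k; exact: measurable_W.
  apply: ge0_le_integral => //.
  - by move=> y _; rewrite lee_fin.
  - exact: measurable_W.
  - apply: ge0_emeasurable_sum => [k y _ _|k _]; first by rewrite lee_fin.
    exact: measurable_W.
  - by move=> y _; apply: IH; exact: ltnW.
have := key n.+1 (leqnn _) (fun=> 0).
have WE c d x : W n.+1 c d x = boxvol c d.
  by apply: eq_bigr => i _; rewrite ltn_ord.
by rewrite WE; under eq_eseriesr do rewrite WE.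
Qed.

End boxes.

(** * Euclidean norm and topology *)

Section euclidean_norm.
Variables (R : realType) (n : nat).
Local Notation E := 'rV[R]_n.
Implicit Types (p q e x y z : E) (A B X : set E).

Lemma enorm_ge0 p : 0 <= enorm p.
Proof. exact: sqrtr_ge0. Qed.

Lemma sqr_enorm p : enorm p ^+ 2 = \sum_(i < n) p ord0 i ^+ 2.
Proof. by rewrite sqr_sqrtr// sumr_ge0// => i _; rewrite sqr_ge0. Qed.

Lemma enorm0 : enorm (0 : E) = 0.
Proof.
apply/eqP; rewrite -sqrf_eq0 sqr_enorm big1// => i _.
by rewrite mxE expr0n.
Qed.

Lemma enormN p : enorm (- p) = enorm p.
Proof. by congr Num.sqrt; apply: eq_bigr => i _; rewrite mxE sqrrN. Qed.

Lemma enormB p q : enorm (p - q) = enorm (q - p).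
Proof. by rewrite -enormN opprB. Qed.

Lemma enormZ (c : R) p : enorm (c *: p) = `|c| * enorm p.
Proof.
apply/eqP; rewrite -(@eqrXn2 _ 2)// ?mulr_ge0// ?enorm_ge0//.
rewrite exprMn !sqr_enorm real_normK ?num_real// mulr_sumr.
by apply/eqP; apply: eq_bigr => i _; rewrite mxE exprMn.
Qed.

Lemma coord_le_enorm p i : `|p ord0 i| <= enorm p.
Proof.
rewrite -ler_sqr ?nnegrE ?enorm_ge0// real_normK ?num_real//.
by rewrite sqr_enorm (bigD1 i)//= lerDl sumr_ge0// => j _; rewrite sqr_ge0.
Qed.

Lemma enorm_eq0 p : enorm p = 0 -> p = 0.
Proof.
move=> p0; apply/rowP => i; rewrite mxE; apply/eqP.
by rewrite -normr_le0 -p0 coord_le_enorm.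
Qed.

(** Expanding sum_i (|q| p_i - |p| q_i)^2 >= 0 leaves 2 |p| |q| (|p| |q| - p.q) >= 0; the zero case
    is split off so that |p| |q| can be cancelled. *)
Lemma cauchy_schwarz p q :
  \sum_(i < n) p ord0 i * q ord0 i <= enorm p * enorm q.
Proof.
have [|pq0] := eqVneq (enorm p * enorm q) 0.
  move=> /eqP; rewrite mulf_eq0 => /orP[] /eqP /[dup] h /enorm_eq0 ->.
    by rewrite enorm0 mul0r big1// => i _; rewrite mxE mul0r.
  by rewrite enorm0 mulr0 big1// => i _; rewrite mxE mulr0.
have pq : 0 < enorm p * enorm q by rewrite lt0r pq0 mulr_ge0 ?enorm_ge0.
have : 0 <= \sum_(i < n) (enorm q * p ord0 i - enorm p * q ord0 i) ^+ 2.
  by apply: sumr_ge0 => i _; rewrite sqr_ge0.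
have -> : \sum_(i < n) (enorm q * p ord0 i - enorm p * q ord0 i) ^+ 2 =
    enorm q ^+ 2 * enorm p ^+ 2 + enorm p ^+ 2 * enorm q ^+ 2 -
    2 * (enorm p * enorm q) * \sum_(i < n) p ord0 i * q ord0 i.
  rewrite {1}[enorm p ^+ 2]sqr_enorm {2}[enorm q ^+ 2]sqr_enorm !mulr_sumr.
  rewrite -big_split -sumrB/=; apply: eq_bigr => i _; ring.
set s := \sum_(i < n) _ => h.
rewrite -(ler_pM2l pq).
by move: h; nra.
Qed.

Lemma ler_enormD p q : enorm (p + q) <= enorm p + enorm q.
Proof.
rewrite -ler_sqr ?nnegrE ?addr_ge0 ?enorm_ge0//.
rewrite sqrrD !sqr_enorm.
under eq_bigr => i _ do rewrite mxE sqrrD.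
rewrite !big_split/= lerD2r lerD2l.
by rewrite mulr2n lerD// cauchy_schwarz.
Qed.

Lemma enorm_triangle x y z : enorm (x - z) <= enorm (x - y) + enorm (y - z).
Proof. by rewrite (le_trans _ (ler_enormD _ _))// addrA subrK. Qed.

Lemma enorm_le_sum p : enorm p <= \sum_(i < n) `|p ord0 i|.
Proof.
rewrite -ler_sqr ?nnegrE ?enorm_ge0 ?sumr_ge0//.
rewrite sqr_enorm.
have : forall (s : seq 'I_n),
   \sum_(i <- s) p ord0 i ^+ 2 <= (\sum_(i <- s) `|p ord0 i|) ^+ 2.
  elim=> [|i s IH]; first by rewrite !big_nil expr0n.
  rewrite !big_cons sqrrD real_normK ?num_real//.
  rewrite -addrA lerD2l (le_trans IH)// lerDr.
  by rewrite mulrn_wge0// mulr_ge0// sumr_ge0.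
exact.
Qed.

Lemma enorm_le_const p (c : R) : (forall i, `|p ord0 i| <= c) ->
  enorm p <= n%:R * c.
Proof.
move=> pc; rewrite (le_trans (enorm_le_sum p))//.
rewrite (le_trans (ler_sum _ (fun i _ => pc i)))//.
by rewrite sumr_const card_ord mulr_natl.
Qed.

(** The topology of row vectors comes from the maximum norm, and the Euclidean norm lies between it
    and n times it. Dividing by [n.+1] makes the bound strict and avoids a zero denominator. *)
Lemma nbhs_enormP p A :
  nbhs p A <-> exists2 r, 0 < r & forall q, enorm (q - p) < r -> A q.
Proof.
split=> [/nbhs_ballP[r /= r0 rA]|[r r0 rA]].
  exists r => // q qp; apply: rA; split => // i j.
  rewrite ord1 /ball/= (le_lt_trans _ qp)// distrC.
  by have := coord_le_enorm (q - p) j; rewrite !mxE.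
apply/nbhs_ballP; exists (r / n.+1%:R) => [|q [_ pq]]; first by rewrite /= divr_gt0.
apply: rA; have r0' : 0 <= r / n.+1%:R by rewrite divr_ge0// ltW.
apply: (@le_lt_trans _ _ (n%:R * (r / n.+1%:R))).
  apply: enorm_le_const => i; have := pq ord0 i; rewrite /ball/= => h.
  by rewrite !mxE distrC ltW.
rewrite mulrCA gtr_pMr// ltr_pdivrMr// mul1r ltr_nat //.
Qed.

Lemma open_enormP A :
  open A <-> forall p, A p -> exists2 r, 0 < r & forall q, enorm (q - p) < r -> A q.
Proof.
by rewrite openE; split=> h p /h; move=> /nbhs_enormP.
Qed.

Lemma closure_enormP p A :
  closure A p <-> forall r, 0 < r -> exists2 q, A q & enorm (q - p) < r.
Proof.
split=> [Ap r r0|h U /nbhs_enormP[r r0 rU]].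
  have /Ap[q [Aq /= qp]] : nbhs p [set q | enorm (q - p) < r].
    by apply/nbhs_enormP; exists r.
  by exists q.
by have [q Aq qp] := h _ r0; exists q; split => //; exact: rU.
Qed.

Definition lipschitz_with (k : R) (f : E -> R) :=
  forall p q, `|f p - f q| <= k * enorm (p - q).

Lemma lipschitz_continuous k f : lipschitz_with k f -> continuous f.
Proof.
move=> fk p; apply: (iffRL (@cvgrPdist_lt _ _ _ _ (nbhs_filter p) _ _)).
move=> r r0; apply/nbhs_enormP.
have k1 : 0 < `|k| + 1 by rewrite ltr_pwDr.
exists (r / (`|k| + 1)); first by rewrite divr_gt0.
move=> q; rewrite ltr_pdivlMr// => h; rewrite /= (le_lt_trans (fk _ _))//.
rewrite enormB (le_lt_trans _ h)// mulrC ler_wpM2l ?enorm_ge0//.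
by rewrite (le_trans (ler_norm _))// lerDl.
Qed.

Lemma closed_ge_continuous (f : E -> R) (c : R) :
  continuous f -> closed [set p | c <= f p].
Proof.
by move=> cf; apply: (@closed_comp _ _ f [set x | c <= x]) => //; exact: closed_ge.
Qed.

Lemma closed_le_continuous (f : E -> R) (c : R) :
  continuous f -> closed [set p | f p <= c].
Proof.
by move=> cf; apply: (@closed_comp _ _ f [set x | x <= c]) => //; exact: closed_le.
Qed.

End euclidean_norm.

(** * Caratheodory measurable sets and the real-valued measure of bounded sets *)

Section measure_facts.
Variables (R : realType) (n : nat).
Local Notation E := 'rV[R]_n.+1.
Local Notation leb := (@leb_outer R n.+1).
Implicit Types (a b p q : E) (A B F X Y Z : set E).

Definition cmeas X := leb.-caratheodory X.

Lemma cmeas0 : cmeas set0.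
Proof. exact: caratheodory_measurable_set0. Qed.

Lemma cmeasC A : cmeas A -> cmeas (~` A).
Proof. exact: caratheodory_measurable_setC. Qed.

Lemma cmeasU A B : cmeas A -> cmeas B -> cmeas (A `|` B).
Proof. exact: caratheodory_measurable_setU. Qed.

Lemma cmeasI A B : cmeas A -> cmeas B -> cmeas (A `&` B).
Proof. exact: caratheodory_measurable_setI. Qed.

Lemma cmeasD A B : cmeas A -> cmeas B -> cmeas (A `\` B).
Proof. exact: caratheodory_measurable_setD. Qed.

Lemma cmeas_bigcup (S : nat -> set E) :
  (forall k, cmeas (S k)) -> cmeas (\bigcup_k S k).
Proof. exact: caratheodory_measurable_bigcup. Qed.

Lemma cmeas_bigcap (S : nat -> set E) :
  (forall k, cmeas (S k)) -> cmeas (\bigcap_k S k).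
Proof.
move=> mS; rewrite -[X in cmeas X]setCK setC_bigcap.
by apply/cmeasC/cmeas_bigcup => k; exact/cmeasC.
Qed.

Lemma leb_outer_null_sub X Y : X `<=` Y -> leb Y = 0%E -> leb X = 0%E.
Proof.
move=> XY Y0; apply/eqP; rewrite eq_le leb_outer_ge0 andbT -Y0.
exact: le_leb_outer.
Qed.

Lemma leb_outer_null_bigcup (S : nat -> set E) :
  (forall k, leb (S k) = 0%E) -> leb (\bigcup_k S k) = 0%E.
Proof.
move=> S0; apply/eqP; rewrite eq_le leb_outer_ge0 andbT.
by rewrite (le_trans (leb_outer_sigma_subadditive S))// eseries0.
Qed.

Lemma leb_outerU2 A B : (leb (A `|` B) <= leb A + leb B)%E.
Proof. exact: (@outer_measureU2 _ _ leb). Qed.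

Lemma leb_outer_nullU X Y : leb X = 0%E -> leb Y = 0%E -> leb (X `|` Y) = 0%E.
Proof.
move=> X0 Y0; apply/eqP; rewrite eq_le leb_outer_ge0 andbT.
by rewrite (le_trans (leb_outerU2 _ _))// X0 Y0 adde0.
Qed.

Lemma cmeas_null X : leb X = 0%E -> cmeas X.
Proof.
move=> X0; apply: (@le_caratheodory_measurable _ _ leb) => Y.
apply: (@le_trans _ _ (0 + leb Y)%E); last by rewrite add0e.
apply: leeD; last by apply: le_leb_outer => p [].
by rewrite -X0; apply: le_leb_outer => p [].
Qed.

Lemma cmeas_hbox a b : cmeas [set p | forall i, a ord0 i < p ord0 i <= b ord0 i].
Proof.
suff H (s : seq 'I_n.+1) :
    cmeas [set p | forall i, i \in s -> a ord0 i < p ord0 i <= b ord0 i].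
  rewrite (_ : mkset _ = [set p | forall i, i \in enum 'I_n.+1 ->
    a ord0 i < p ord0 i <= b ord0 i]) //.
  by apply/seteqP; split => p /= h i; [move=> _|]; apply: h; rewrite ?mem_enum.
elim: s => [|j s IH].
  rewrite (_ : mkset _ = ~` set0); first exact/cmeasC/cmeas0.
  by rewrite setC0; apply/seteqP; split.
rewrite (_ : mkset _ = ([set p | p ord0 j <= b ord0 j] `\` [set p | p ord0 j <= a ord0 j])
   `&` [set p | forall i, i \in s -> a ord0 i < p ord0 i <= b ord0 i]).
  by apply: cmeasI => //; apply: cmeasD; exact: caratheodory_halfspace.
apply/seteqP; split => p /=.
  move=> h; have /andP[h1 h2] := h j (mem_head _ _); split.
    by split => //; apply/negP; rewrite -ltNge.
  by move=> i si; apply: h; rewrite inE si orbT.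
move=> [[h1 /negP]]; rewrite -ltNge => h2 h i; rewrite inE => /orP[/eqP ->|/h//].
by rewrite h1 h2.
Qed.

(** An open set is the union of the half-open boxes with rational corners that it contains;
    [unpickle] enumerates the pairs of corners. *)
Lemma cmeas_open X : open X -> cmeas X.
Proof.
move=> /open_enormP oX.
pose hb (u : 'rV[rat]_n.+1 * 'rV[rat]_n.+1) : set E :=
  [set p | forall i, ratr (u.1 ord0 i) < p ord0 i <= ratr (u.2 ord0 i)].
pose S k : set E := if unpickle k is Some u then
  if `[< hb u `<=` X >] then hb u else set0 else set0.
have mS k : cmeas (S k).
  rewrite /S; case: unpickle => [u|]; last exact: cmeas0.
  case: ifPn => _; last exact: cmeas0.
  have := cmeas_hbox (map_mx ratr u.1) (map_mx ratr u.2).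
  congr cmeas; apply/seteqP; split=> p /= h i; have := h i; rewrite !mxE //.
suff -> : X = \bigcup_k S k by exact: cmeas_bigcup.
apply/seteqP; split => [p Xp|p [k _]]; last first.
  rewrite /S; case: unpickle => [u|]//; case: ifPn => // /asboolP h; exact: h.
have [r r0 rX] := oX _ Xp.
(* Points whose coordinates are within [d] of those of [p] stay in the ball, as (n + 1) d < r. *)
pose d := r / n.+2%:R.
have d0 : 0 < d by rewrite divr_gt0.
have ex1 i : {q : rat | ratr q \in `](p ord0 i - d), (p ord0 i)[ }.
  by apply: cid; apply: rat_in_itvoo; rewrite ltrBlDr ltrDl.
have ex2 i : {q : rat | ratr q \in `](p ord0 i), (p ord0 i + d)[ }.
  by apply: cid; apply: rat_in_itvoo; rewrite ltrDl.
pose u := (\row_i sval (ex1 i), \row_i sval (ex2 i)).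
have up : hb u p.
  move=> i; rewrite /= !mxE; case: (ex1 i) => /= x; case: (ex2 i) => /= y.
  by rewrite !in_itv/= => /andP[h1 h2] /andP[h3 h4]; rewrite h4 ltW.
exists (pickle u) => //; rewrite /S pickleK ifT//; apply/asboolP => q hq.
apply: rX; apply: (@le_lt_trans _ _ (n.+1%:R * d)).
  apply: enorm_le_const => i; have := hq i; rewrite /= !mxE.
  case: (ex1 i) => /= x; case: (ex2 i) => /= y.
  rewrite !in_itv/= => /andP[h1 h2] /andP[h3 h4] /andP[h5 h6].
  by rewrite ler_norml; apply/andP; split; lra.
by rewrite /d mulrCA gtr_pMr// ltr_pdivrMr// mul1r ltr_nat.
Qed.

Lemma cmeas_closed X : closed X -> cmeas X.
Proof. by move=> cX; rewrite -[X]setCK; apply/cmeasC/cmeas_open/closed_openC. Qed.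

(** A small cube around a point has positive volume; here the lower bound for the outer measure of
    boxes enters. *)
Lemma leb_outer_open_gt0 X : open X -> X !=set0 -> (0 < leb X)%E.
Proof.
move=> /open_enormP oX [p Xp]; have [r r0 rX] := oX _ Xp.
pose d := r / n.+2%:R.
have d0 : 0 < d by rewrite divr_gt0.
pose a : E := \row_i (p ord0 i - d); pose b : E := \row_i (p ord0 i + d).
apply: (@lt_le_trans _ _ (leb (box a b))).
  apply: lt_le_trans (boxvol_le_leb_outer _ _).
  rewrite lte_fin; apply: prodr_gt0 => i _; rewrite !mxE lt_max.
  by apply/orP; left; lra.
apply: le_leb_outer => q qab; apply: rX.
apply: (@le_lt_trans _ _ (n.+1%:R * d)).
  apply: enorm_le_const => i; have := qab i; rewrite !mxE.
  by rewrite ler_norml => /andP[h1 h2]; apply/andP; split; lra.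
by rewrite /d mulrCA gtr_pMr// ltr_pdivrMr// mul1r ltr_nat.
Qed.

Lemma bounded_subset A B : A `<=` B -> bounded_set B -> bounded_set A.
Proof. by move=> AB [M BM]; exists M => p /AB /BM. Qed.

Lemma boundedU A B : bounded_set A -> bounded_set B -> bounded_set (A `|` B).
Proof.
move=> [M AM] [N BN]; exists (Num.max M N) => p [/AM|/BN] h.
  by rewrite le_max h.
by rewrite le_max h orbT.
Qed.

Lemma boundedD A B : bounded_set A -> bounded_set (A `\` B).
Proof. by apply: bounded_subset => p []. Qed.

Lemma boundedIl A B : bounded_set A -> bounded_set (A `&` B).
Proof. by apply: bounded_subset => p []. Qed.

Lemma boundedIr A B : bounded_set B -> bounded_set (A `&` B).
Proof. by apply: bounded_subset => p []. Qed.

Lemma leb_outer_fin X : bounded_set X -> leb X \is a fin_num.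
Proof.
move=> [M XM]; rewrite ge0_fin_numE ?leb_outer_ge0//.
pose a : E := \row_i (- M); pose b : E := \row_i M.
apply: (@le_lt_trans _ _ (leb (box a b))).
  apply: le_leb_outer => p /XM pM i; rewrite !mxE -ler_norml.
  exact: le_trans (coord_le_enorm _ _) pM.
exact: le_lt_trans (leb_outer_box _ _) (ltry _).
Qed.

Lemma leb_outerE X : bounded_set X -> leb X = (mu X)%:E.
Proof. by move=> bX; rewrite /mu fineK// leb_outer_fin. Qed.

Lemma mu_ge0 X : 0 <= mu X.
Proof. by rewrite fine_ge0// leb_outer_ge0. Qed.

Lemma mu_null X : leb X = 0%E -> mu X = 0.
Proof. by rewrite /mu => ->. Qed.

Lemma null_mu X : bounded_set X -> mu X = 0 -> leb X = 0%E.
Proof. by move=> /leb_outerE -> ->. Qed.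

Lemma mu_set0 : mu (set0 : set E) = 0.
Proof. exact/mu_null/leb_outer_set0. Qed.

Lemma le_mu A B : A `<=` B -> bounded_set B -> mu A <= mu B.
Proof.
move=> AB bB; rewrite -lee_fin -!leb_outerE//; first exact: le_leb_outer.
exact: bounded_subset bB.
Qed.

Lemma mu_setU_le A B : bounded_set A -> bounded_set B ->
  mu (A `|` B) <= mu A + mu B.
Proof.
move=> bA bB; rewrite -lee_fin EFinD -!leb_outerE//; last exact: boundedU.
exact: leb_outerU2.
Qed.

Lemma mu_split X Y : bounded_set X -> cmeas Y -> mu X = mu (X `&` Y) + mu (X `\` Y).
Proof.
move=> bX mY; apply: EFin_inj; have := mY X; rewrite -setDE.
by rewrite !leb_outerE//; [exact: boundedD|exact: boundedIl].
Qed.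

Lemma mu_setD X Y : bounded_set X -> cmeas Y -> Y `<=` X ->
  mu (X `\` Y) = mu X - mu Y.
Proof.
move=> bX mY YX; rewrite (mu_split bX mY) (_ : X `&` Y = Y); first by lra.
by apply/seteqP; split => [p []//|p Yp]; split => //; exact: YX.
Qed.

(** Continuity from below of the measure that [leb] induces on its Caratheodory sets;
    [caratheodory_type] carries that sigma-algebra. *)
Lemma mu_cup_limit (S : nat -> set E) (e : R) :
  (forall k, cmeas (S k)) -> nondecreasing_seq S -> bounded_set (\bigcup_k S k) ->
  0 < e -> exists k, mu (\bigcup_k S k) - e < mu (S k).
Proof.
move=> mS ndS bS e0.
pose m : {outer_measure set E -> \bar R} := leb.
have := @nondecreasing_cvg_mu _ (caratheodory_type m) R m S mS
  (cmeas_bigcup mS) ndS.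
rewrite /m/= leb_outerE//= => /fine_cvg /cvgrPdist_lt /(_ _ e0) [k _ /(_ _ (leqnn k))].
rewrite /= -/(mu (S k)) => h; exists k.
by move: h; rewrite ltr_norml; lra.
Qed.

Lemma mu_cap_limit (S : nat -> set E) (e : R) :
  (forall k, cmeas (S k)) -> nonincreasing_seq S -> bounded_set (S 0%N) ->
  0 < e -> exists k, mu (S k) < mu (\bigcap_k S k) + e.
Proof.
move=> mS niS bS e0.
have foo : (leb (S 0%N) < +oo)%E by rewrite leb_outerE// ltry.
pose m : {outer_measure set E -> \bar R} := leb.
have := @nonincreasing_cvg_mu _ (caratheodory_type m) R m S foo mS
  (cmeas_bigcap mS) niS.
have bI : bounded_set (\bigcap_k S k) by apply: bounded_subset bS => p; exact.
rewrite /m/= leb_outerE//= => /fine_cvg /cvgrPdist_lt /(_ _ e0) [k _ /(_ _ (leqnn k))].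
rewrite /= -/(mu (S k)) => h; exists k.
by move: h; rewrite ltr_norml; lra.
Qed.

End measure_facts.

(** * Porous sets are null *)

Section porous.
Variables (R : realType) (n : nat).
Local Notation E := 'rV[R]_n.+1.
Local Notation leb := (@leb_outer R n.+1).
Implicit Types (p q x z : E) (X : set E).

Let cube x (l : R) := box x (x + const_mx l).

Let boxvol_cube x l : 0 <= l -> boxvol x (x + const_mx l) = l ^+ n.+1.
Proof.
move=> l0; rewrite /boxvol (eq_bigr (fun=> l)).
  by rewrite prodr_const card_ord.
by move=> i _; rewrite !mxE addrAC subrr add0r max_l.
Qed.

Let interval_cell (m : nat) (l y : R) : 0 < l -> 0 <= y <= l ->
  exists k : 'I_m.+1, k%:R * (l / m.+1%:R) <= y <= k%:R * (l / m.+1%:R) + l / m.+1%:R.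
Proof.
move=> l0 /andP[y0 yl]; set h := l / m.+1%:R.
have h0 : 0 < h by rewrite divr_gt0.
have lE : l = h * m.+1%:R by rewrite /h divfK.
have yh0 : 0 <= y / h by rewrite divr_ge0// ltW.
have /andP[t1 t2] := truncn_itv yh0.
(* For y = l the truncation is [m.+1], one cell too far; the minimum sends it back to the last
   cell. *)
have tm : (minn (Num.truncn (y / h)) m < m.+1)%N by rewrite ltnS geq_minr.
exists (Ordinal tm) => /=; rewrite -ler_pdivlMr//.
apply/andP; split.
  by rewrite (le_trans _ t1)// ler_nat geq_minl.
have -> : forall k : nat, k%:R * h + h = k.+1%:R * h :> R.
  by move=> k; rewrite -natr1; ring.
rewrite -ler_pdivrMr//; have [tm'|mt] := leqP (Num.truncn (y / h)) m.
  exact: ltW.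
by rewrite ler_pdivrMr// mulrC -lE.
Qed.

Let leb_outer_seq (I : eqType) (s : seq I) (F : I -> set E) X :
  (forall p, X p -> exists2 i, i \in s & F i p) ->
  (leb X <= \sum_(i <- s) leb (F i))%E.
Proof.
elim: s X => [|i s IH] X XF.
  rewrite big_nil (_ : X = set0) ?leb_outer_set0//.
  by apply/seteqP; split => // p /XF[].
rewrite big_cons; apply: (@le_trans _ _ (leb (F i `|` (X `\` F i)))).
  apply: le_leb_outer => p Xp; have [|] := pselect (F i p); first by left.
  by right.
rewrite (le_trans (leb_outerU2 _ _))// leeD2l// IH// => p [/XF[j + Fjp]].
by rewrite inE => /orP[/eqP <-//|js] _; exists j.
Qed.

(* Some cell of a fine subdivision of a cube misses [X]; iterating, [X] fills at most the fraction [th ^ j] of every small cube. *)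
Lemma porous_null X (c d0 : R) : 0 < c -> 0 < d0 ->
  (forall p d, X p -> 0 < d <= d0 ->
     exists2 p', enorm (p' - p) <= d & forall z, enorm (z - p') < c * d -> ~ X z) ->
  leb X = 0%E.
Proof.
(* With c <= 1 the ball of radius c l / 8 about the centre of a cube lies in the ball of radius l /
   4 that is tested for points of X below. *)
wlog c1 : c / c <= 1.
  move=> W c0 d00 h.
  apply: (W (Num.min c 1) _ _ d00); rewrite ?ge_min ?lexx ?orbT ?lt_min ?c0//=.
  move=> p d Xp /[dup] dd /(h _ _ Xp)[p' p'p h']; exists p' => // z zp'.
  apply: h'; rewrite (lt_le_trans zp')// ler_wpM2r ?ge_min ?lexx//.
  by case/andP: dd => /ltW.
move=> c0 d00 h.
(* So fine that a cell of a cube of side l, of diameter at most (n + 1) l / (m + 1), lies within c l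
   / 8 of each of its points. *)
pose m := Num.truncn (8 * n.+1%:R / c).
have mP : n.+1%:R / m.+1%:R < c / 8.
  have /truncn_itv/andP[_] : 0 <= 8 * n.+1%:R / c by rewrite divr_ge0 ?mulr_ge0 ?ltW.
  rewrite -/m ltr_pdivrMr// => h1.
  by rewrite ltr_pdivrMr//; nra.
pose sub x (l : R) (k : {ffun 'I_n.+1 -> 'I_m.+1}) : E :=
  \row_i (x ord0 i + (k i)%:R * (l / m.+1%:R)).
have cell x l p : 0 < l -> cube x l p ->
    exists k, cube (sub x l k) (l / m.+1%:R) p.
  move=> l0 xp.
  have /choice[k hk] : forall i, exists k : 'I_m.+1,
     k%:R * (l / m.+1%:R) <= p ord0 i - x ord0 i <= k%:R * (l / m.+1%:R) + l / m.+1%:R.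
    by move=> i; apply: interval_cell => //; have := xp i; rewrite !mxE; lra.
  exists (finfun k) => i; have := hk i; rewrite /sub !mxE ffunE.
  by set h' := l / _; set kh := _ * h' => /andP[? ?]; apply/andP; split; lra.
have hole x l : 0 < l <= d0 -> exists k, forall z,
    cube (sub x l k) (l / m.+1%:R) z -> ~ X z.
  move=> /andP[l0 ld].
  (* If X has a point within l / 4 of the centre, porosity at scale l / 8 yields a hole centred
     within 3 l / 8 of the centre; otherwise the centre itself serves. *)
  have [p' xp' hp'] : exists2 p', cube x l p' &
      forall z, enorm (z - p') < c * (l / 8) -> ~ X z.
    pose x0 : E := x + const_mx (l / 2).
    have x0P z : enorm (z - x0) <= l / 2 -> cube x l z.
      move=> zx i; have := le_trans (coord_le_enorm _ i) zx.
      by rewrite !mxE ler_norml => /andP[? ?]; apply/andP; split; lra.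
    have [[p [Xp px]]|nX] := pselect (exists p, X p /\ enorm (p - x0) <= l / 4).
      have [|p' p'p hp'] := h p (l / 8) Xp; first by apply/andP; split; lra.
      exists p' => //; apply: x0P.
      have := enorm_triangle p' p x0; lra.
    exists x0 => [|z zx Xz]; first by apply: x0P; rewrite subrr enorm0; lra.
    apply: nX; exists z; split => //; rewrite (le_trans (ltW zx))//.
    by nra.
  have [k hk] := cell _ _ _ l0 xp'; exists k => z hz; apply: hp'.
  apply: (@le_lt_trans _ _ (n.+1%:R * (l / m.+1%:R))).
    apply: enorm_le_const => i; have := hz i; have := hk i; rewrite /sub !mxE.
    set h' := l / _; set kh := _ * h'.
    move=> /andP[? ?] /andP[? ?].
    by rewrite ler_norml; apply/andP; split; lra.
  have -> : n.+1%:R * (l / m.+1%:R) = n.+1%:R / m.+1%:R * l by ring.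
  have -> : c * (l / 8) = c / 8 * l by ring.
  by rewrite ltr_pM2r.
pose K := (m.+1 ^ n.+1)%N.
have K0 : (0 < K)%N by rewrite expn_gt0.
have K0R : 0 < K%:R :> R by rewrite ltr0n.
(* [K] is the number of cells, at least one of which misses X. *)
pose th : R := K.-1%:R / K%:R.
have th0 : 0 <= th by rewrite divr_ge0.
have th1 : th < 1 by rewrite ltr_pdivrMr// mul1r ltr_nat prednK.
have fill j : forall x l, 0 < l <= d0 ->
    (leb (X `&` cube x l) <= (th ^+ j * l ^+ n.+1)%:E)%E.
  elim: j => [|j IH] x l ld; have /andP[l0 ld0] := ld.
    rewrite mul1r -(boxvol_cube x (ltW l0)).
    by apply: le_trans (leb_outer_box _ _); apply: le_leb_outer => p [].
  have [k0 hk0] := hole x l ld.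
  set l' := l / m.+1%:R.
  have l'0 : 0 < l' by rewrite divr_gt0.
  have l'd : 0 < l' <= d0.
    rewrite l'0 (le_trans _ ld0)// ler_pdivrMr// ler_peMr// ?ler1n//; exact: ltW.
  apply: le_trans (@leb_outer_seq _ [seq k <- enum {ffun 'I_n.+1 -> 'I_m.+1} | k != k0]
     (fun k => X `&` cube (sub x l k) l') _ _) _.
    move=> p [Xp xp]; have [k hk] := cell _ _ _ l0 xp.
    exists k => //; rewrite mem_filter mem_enum andbT.
    by apply/eqP => kk0; apply: hk0 Xp; rewrite -kk0.
  apply: le_trans (lee_sum _ (fun k _ => IH (sub x l k) l' l'd)) _.
  rewrite sumEFin lee_fin big_filter big_enum_cond/= sumr_const.
  rewrite (_ : #|_| = K.-1); last first.
    by have := cardC1 k0; rewrite card_ffun !card_ord -/K => <-; apply: eq_card.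
  have -> : th ^+ j.+1 * l ^+ n.+1 = K.-1%:R * (th ^+ j * l' ^+ n.+1).
    by rewrite /l' (exprMn n.+1 l) exprVn -natrX -/K (exprS th) {1}/th; ring.
  by rewrite mulr_natl.
have null x : leb (X `&` cube x d0) = 0%E.
  apply/eqP; rewrite eq_le leb_outer_ge0 andbT; apply/lee_addgt0Pr => e e0.
  rewrite add0e.
  have : (fun j => th ^+ j * d0 ^+ n.+1) @ \oo --> 0 * d0 ^+ n.+1.
    by apply: cvgM; [apply: cvg_expr; rewrite ger0_norm|exact: cvg_cst].
  rewrite mul0r => /cvgrPdist_lt /(_ _ e0) [j _ /(_ _ (leqnn j))] /=.
  rewrite sub0r normrN => hj.
  have dd : 0 < d0 <= d0 by rewrite d00 lexx.
  rewrite (le_trans (fill j x _ dd))// lee_fin ltW//.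
  by rewrite (le_lt_trans (ler_norm _)).
pose S k := if unpickle k is Some u then
  X `&` cube (\row_i (((u : 'rV[int]_n.+1) ord0 i)%:~R * d0)) d0 else set0.
apply: (@leb_outer_null_sub _ _ _ (\bigcup_k S k)); last first.
  apply: leb_outer_null_bigcup => k; rewrite /S.
  by case: unpickle => [u|]; rewrite ?null ?leb_outer_set0.
move=> p Xp; pose u : 'rV[int]_n.+1 := \row_i Num.floor (p ord0 i / d0).
exists (pickle u) => //; rewrite /S pickleK; split => // i; rewrite !mxE.
have /andP[] := floor_itv (p ord0 i / d0).
rewrite ler_pdivlMr// ltr_pdivrMr// intrD mulrDl mul1r => -> /ltW ->.
by [].
Qed.

End porous.

(** * Signed distance *)

Section signed_distance.
Variables (R : realType) (n : nat).
Local Notation E := 'rV[R]_n.+1.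
Implicit Types (p q e x z : E) (A B X V : set E).

Lemma dist_ge0 q X : 0 <= dist q X.
Proof.
have [[e Xe]|X0] := pselect (X !=set0).
  by apply: lb_le_inf; [exists (enorm (q - e)), e|move=> _ [e' _ <-]; exact: enorm_ge0].
have -> : X = set0 by apply/seteqP; split => // x Xx; apply: X0; exists x.
by rewrite /dist image_set0 inf0.
Qed.

Lemma dist_le q X e : X e -> dist q X <= enorm (q - e).
Proof.
move=> Xe; apply: ge_inf; last by exists e.
by exists 0 => _ [e' _ <-]; exact: enorm_ge0.
Qed.

Lemma dist_lb q X c : X !=set0 -> (forall e, X e -> c <= enorm (q - e)) ->
  c <= dist q X.
Proof.
move=> [e Xe] h; apply: lb_le_inf; first by exists (enorm (q - e)), e.
by move=> _ [e' Xe' <-]; exact: h.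
Qed.

Lemma dist_approx q X c : X !=set0 -> dist q X < c ->
  exists2 e, X e & enorm (q - e) < c.
Proof.
move=> X0 qc; apply: contrapT => h; move: qc; apply/negP; rewrite -leNgt.
by apply: dist_lb => // e Xe; rewrite leNgt; apply/negP => ec; apply: h; exists e.
Qed.

Lemma dist_lipschitz X : X !=set0 -> lipschitz_with 1 (fun q => dist q X).
Proof.
move=> X0 p q; rewrite mul1r ler_norml; apply/andP; split.
  rewrite lerBrDl -lerBrDr opprK addrC -lerBlDl; apply: dist_lb => // e Xe.
  have := dist_le q Xe; have := enorm_triangle q p e; rewrite (enormB q p).
  lra.
rewrite lerBlDr -lerBlDl; apply: dist_lb => // e Xe.
have := dist_le p Xe; have := enorm_triangle p q e; lra.
Qed.

Lemma dist_eq0 q X : X !=set0 -> dist q X = 0 <-> closure X q.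
Proof.
move=> X0; split=> [q0|/closure_enormP clq].
  apply/closure_enormP => r r0; have [|e Xe qe] := @dist_approx q X r X0.
    by rewrite q0.
  by exists e; rewrite // enormB.
apply/eqP; rewrite eq_le dist_ge0 andbT; apply/ler_addgt0Pr => r r0.
have [e Xe eq] := clq _ r0; rewrite add0r (le_trans (dist_le q Xe))//.
by rewrite enormB ltW.
Qed.

Lemma bdryP A p : bdry A p <-> forall r, 0 < r ->
  (exists2 q, A q & enorm (q - p) < r) /\ (exists2 q, ~ A q & enorm (q - p) < r).
Proof.
split=> [[/closure_enormP clp nip] r r0|h].
  split; first exact: clp.
  apply: contrapT => h; apply: nip; apply/nbhs_enormP; exists r => // q qp.
  by apply: contrapT => nAq; apply: h; exists q.
split; first by apply/closure_enormP => r /h[].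
by move=> /nbhs_enormP[r r0 rA]; have [_ [q nAq /rA]] := h _ r0.
Qed.

Lemma bdry_closure A : bdry A `<=` closure A.
Proof. by move=> p []. Qed.

Lemma closed_bdry A : closed (bdry A).
Proof.
rewrite /bdry setDE; apply: closedI; first exact: closed_closure.
by apply: open_closedC; exact: open_interior.
Qed.

Lemma segment_enorm p q (s t : R) :
  enorm ((p + s *: (q - p)) - (p + t *: (q - p))) = `|s - t| * enorm (q - p).
Proof. by rewrite -enormZ scalerBl opprD addrACA subrr add0r. Qed.

Lemma segment_enorm0 p q (t : R) : enorm (p - (p + t *: (q - p))) = `|t| * enorm (q - p).
Proof. by rewrite opprD addrA subrr add0r enormN enormZ. Qed.

Lemma segment_enorm1 p q (t : R) :
  enorm ((p + t *: (q - p)) - q) = `|1 - t| * enorm (q - p).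
Proof.
rewrite distrC -enormZ; congr enorm.
by apply/rowP => i; rewrite !mxE; ring.
Qed.

(** The crossing point is at the supremum of the parameters for which the segment is in A. The
    equality of lengths records that [z] lies on the segment. *)
Lemma bdry_crossing A p q : A p -> ~ A q ->
  exists2 z, bdry A z & enorm (p - z) + enorm (z - q) = enorm (p - q).
Proof.
move=> Ap nAq.
pose g t : E := p + t *: (q - p).
pose S := [set t : R | 0 <= t <= 1 /\ A (g t)].
have S0 : S 0 by split; rewrite ?lexx ?ler01// /g scale0r addr0.
have ubS : ubound S 1 by move=> t [/andP[]].
have hsS : has_sup S by split; [exists 0|exists 1].
have t0 : 0 <= sup S by apply: sup_ubound S0; case: hsS.
have t1 : sup S <= 1 by apply: ge_sup => //; exists 0.
set t := sup S in t0 t1 *.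
pose L := enorm (q - p).
have L0 : 0 <= L := enorm_ge0 _.
exists (g t); last first.
  rewrite segment_enorm0 segment_enorm1 !ger0_norm ?subr_ge0// (enormB p q).
  by rewrite -mulrDl addrC subrK mul1r.
apply/bdryP => r r0.
pose d := r / (L + 1).
have d0 : 0 < d by rewrite divr_gt0// ltr_wpDl.
have dL u : `|u - t| < d -> enorm (g u - g t) < r.
  rewrite segment_enorm -/L ltr_pdivlMr ?ltr_wpDl// => h.
  by rewrite (le_lt_trans _ h)// ler_wpM2l// lerDl.
split.
  have [u Su ut] := sup_adherent d0 hsS; exists (g u); first by case: Su.
  apply: dL; have : u <= t by apply: sup_ubound Su; case: hsS.
  by rewrite ltr_norml -/t in ut *; lra.
(* At t = 1 the end point q itself is the nearby point outside A; for t < 1 a slightly larger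
   parameter gives one. *)
have [t1'|t1'] := ltP t 1; last first.
  exists q => //; have -> : q = g t.
    have -> : t = 1 by apply/eqP; rewrite eq_le t1.
    by rewrite /g scale1r addrC subrK.
  by rewrite subrr enorm0.
pose u := Num.min 1 (t + d / 2).
have tu : t < u by rewrite lt_min t1' ltrDl divr_gt0.
exists (g u).
  move=> Au; have := tu; apply/negP; rewrite -leNgt; apply: sup_ubound; first by case: hsS.
  by split => //; rewrite ge_min lexx (le_trans t0 (ltW tu)).
apply: dL; have : u <= t + d / 2 by rewrite ge_min lexx orbT.
by rewrite ltr_norml; lra.
Qed.

Lemma bdry_nonempty A : A !=set0 -> bounded_set A -> bdry A !=set0.
Proof.
move=> [p Ap] [M AM].
have nA : ~ A (const_mx (`|M| + 1)).
  move=> /AM; apply/negP; rewrite -ltNge.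
  apply: lt_le_trans (coord_le_enorm _ ord0); rewrite mxE.
  by rewrite (lt_le_trans _ (ler_norm _))// (le_lt_trans (ler_norm _))// ltrDl.
by have [z] := bdry_crossing Ap nA; exists z.
Qed.

Lemma normr_dS p A : `|dS p A| = dist p (bdry A).
Proof.
rewrite /dS; case: ifP => _; last rewrite normrN.
  by rewrite ger0_norm ?dist_ge0.
by rewrite ger0_norm ?dist_ge0.
Qed.

Lemma dS_in p A : A p -> dS p A = dist p (bdry A).
Proof. by move=> Ap; rewrite /dS asboolT. Qed.

Lemma dS_out p A : ~ A p -> dS p A = - dist p (bdry A).
Proof. by move=> Ap; rewrite /dS asboolF. Qed.

(** If one point is in A and the other is not, the segment between them meets the boundary, so the
    two distances sum to at most its length. On the same side this is the bound for [dist]. *)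
Lemma dS_lipschitz A : bdry A !=set0 -> lipschitz_with 1 (fun p => dS p A).
Proof.
move=> bA p q; have := dist_lipschitz bA p q; rewrite mul1r.
wlog : p q / A p \/ ~ A q.
  move=> W; have [Ap|Ap] := pselect (A p); first by apply: W; left.
  have [Aq|Aq] := pselect (A q); last by apply: W; right.
  rewrite (enormB p) distrC => h; rewrite distrC; apply: W => //; by left.
have opp x y : A x -> ~ A y -> `|dS x A - dS y A| <= enorm (x - y).
  move=> Ax nAy; rewrite dS_in// dS_out// opprK.
  have [z bz <-] := bdry_crossing Ax nAy.
  rewrite ger0_norm ?addr_ge0 ?dist_ge0//.
  by rewrite lerD ?dist_le// enormB dist_le.
have [Ap|Ap] := pselect (A p); have [Aq|Aq] := pselect (A q) => // hpq.
- by rewrite !dS_in.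
- by move=> _; exact: opp.
- by case: hpq.
- by rewrite !dS_out//; move: (dist p _) (dist q _) => a b; rewrite -opprD normrN.
Qed.

(** For p in B and a boundary point e of A, either e is in B, and then on the boundary of B because
    the interior of B is inside that of A, or the segment from p to e meets the boundary of B. The
    case of p outside A is dual; in between the signs decide. *)
Lemma le_dS A B p : B `<=` A -> bdry A !=set0 -> bdry B !=set0 ->
  dS p B <= dS p A.
Proof.
move=> BA bA bB.
have [Bp|Bp] := pselect (B p).
  rewrite !dS_in//; last exact: BA.
  apply: dist_lb => // e [_ nie].
  have [Be|Be] := pselect (B e).
    apply: dist_le; split; first exact: subset_closure.
    by move=> h; apply: nie; apply: filterS h.
  have [z bz zE] := bdry_crossing Bp Be.
  rewrite (le_trans (dist_le p bz))// -zE lerDl enorm_ge0.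
  by [].
rewrite (dS_out Bp).
have [Ap|Ap] := pselect (A p).
  by rewrite dS_in// (@le_trans _ _ 0)// ?oppr_le0 dist_ge0.
rewrite dS_out// lerN2; apply: dist_lb => // e [cle _].
have [Ae|Ae] := pselect (A e).
  have [z bz zE] := bdry_crossing Ae Ap.
  rewrite (le_trans (dist_le p bz))// (enormB p e) -zE (enormB p z) lerDr.
  exact: enorm_ge0.
apply: dist_le; split; first exact: closure_subset cle.
by move/interior_subset.
Qed.

Lemma dS_ge0 A p : bdry A !=set0 -> 0 <= dS p A <-> closure A p.
Proof.
move=> bA; have [Ap|Ap] := pselect (A p).
  by rewrite dS_in// dist_ge0; split => // _; exact: subset_closure.
rewrite dS_out// oppr_ge0; split=> [h|clp].
  apply: bdry_closure; rewrite ((closure_id _).1 (@closed_bdry A)).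
  by apply/dist_eq0 => //; apply/eqP; rewrite eq_le h dist_ge0.
suff -> : dist p (bdry A) = 0 by [].
apply/dist_eq0 => //; apply: subset_closure; split => //.
by move/interior_subset.
Qed.

Lemma dS_eq0 A p : bdry A !=set0 -> dS p A = 0 <-> bdry A p.
Proof.
move=> bA; rewrite ((closure_id _).1 (@closed_bdry A)) -dist_eq0//.
by rewrite -normr_dS; split=> [->|/normr0_eq0//]; rewrite normr0.
Qed.

Lemma dS_gt0 A p : bdry A !=set0 -> 0 < dS p A <-> interior A p.
Proof.
move=> bA; split=> [h|iA].
  apply: contrapT => nip; have clp : closure A p by apply/(dS_ge0 p bA); exact: ltW.
  have : bdry A p by split.
  by move/(dS_eq0 p bA) => h0; rewrite h0 ltxx in h.
rewrite lt0r; apply/andP; split; last first.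
  by apply/(dS_ge0 p bA); apply: subset_closure; exact: interior_subset.
by apply/eqP => /(dS_eq0 p bA)[].
Qed.

Lemma closure_bounded A M : (forall p, A p -> enorm p <= M) ->
  forall p, closure A p -> enorm p <= M.
Proof.
move=> AM p /closure_enormP clp; apply/ler_addgt0Pr => r r0.
have [q Aq qp] := clp _ r0; have := AM _ Aq.
have := enorm_triangle p q 0; rewrite !subr0 enormB; lra.
Qed.

Lemma bounded_closure A : bounded_set A -> bounded_set (closure A).
Proof. by move=> [M AM]; exists M; exact: closure_bounded. Qed.

Lemma dS_decay A : bdry A !=set0 -> bounded_set A ->
  exists M, forall p, dS p A <= M - enorm p.
Proof.
(* On A, |p| + |e| <= 3 M - |p| since |p| and |e| are at most M; off A the bound M - |p| is enough,
   as M >= 0. *)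
move=> [e be] [M AM]; exists (3 * M) => p.
have clM := closure_bounded AM.
have eM := clM _ (bdry_closure be).
have [Ap|Ap] := pselect (A p).
  have pM := AM _ Ap.
  rewrite dS_in//; have := dist_le p be; have := ler_enormD p (- e).
  by rewrite enormN; lra.
rewrite dS_out//; suff : enorm p - M <= dist p (bdry A).
  by have := enorm_ge0 e; lra.
apply: dist_lb; first by exists e.
move=> e' be'; have := clM _ (bdry_closure be').
have := enorm_triangle p e' 0; rewrite !subr0; lra.
Qed.

End signed_distance.

(** * Null level sets and an intermediate value theorem for measures *)

Section level_sets.
Variables (R : realType) (n : nat).
Local Notation E := 'rV[R]_n.+1.
Local Notation leb := (@leb_outer R n.+1).
Implicit Types (p q e x z : E) (A B X V : set E).

Lemma leb_outer_set1 q : leb [set q] = 0%E.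
Proof.
apply/eqP; rewrite eq_le leb_outer_ge0 andbT.
apply: (@le_trans _ _ (boxvol q q)%:E).
  apply: le_trans (leb_outer_box _ _).
  by apply: le_leb_outer => p -> i; rewrite lexx.
by rewrite lee_fin /boxvol (bigD1 ord0)//= subrr maxxx mul0r.
Qed.

Lemma lipschitzD (k l : R) (f g : E -> R) : lipschitz_with k f ->
  lipschitz_with l g -> lipschitz_with (k + l) (fun p => f p + g p).
Proof.
move=> fk gl p q; rewrite opprD addrACA mulrDl.
by rewrite (le_trans (ler_normD _ _))// lerD.
Qed.

Lemma lipschitzZ (c k : R) (f : E -> R) : lipschitz_with k f ->
  lipschitz_with (`|c| * k) (fun p => c * f p).
Proof. by move=> fk p q; rewrite -mulrBr normrM -mulrA ler_wpM2l. Qed.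

Lemma lipschitz_enormB q : lipschitz_with 1 (fun p => enorm (p - q)).
Proof.
move=> x y; rewrite mul1r ler_norml.
have := enorm_triangle x y q; have := enorm_triangle y x q.
by rewrite (enormB y x) => ? ?; apply/andP; split; lra.
Qed.

(** Where |f p'| >= c d, the Lipschitz constant 2 keeps f nonzero in the ball of radius c d / 2
    about p', which is the hole required for porosity. The value 2 fits a sum of two functions of
    constant at most 1. *)
Lemma zero_set_null (f : E -> R) X (c d0 : R) : 0 < c -> 0 < d0 ->
  lipschitz_with 2 f -> (forall p, X p -> f p = 0) ->
  (forall p d, X p -> 0 < d <= d0 ->
    exists2 p', enorm (p' - p) <= d & c * d <= `|f p'|) ->
  leb X = 0%E.
Proof.
move=> c0 d00 f2 Xf h; apply: (@porous_null _ _ _ (c / 2) d0); rewrite ?divr_gt0//.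
move=> p d Xp dd; have [p' p'p fp'] := h _ _ Xp dd.
exists p' => // z zp' Xz; have := f2 p' z; rewrite (Xf _ Xz) subr0 enormB.
lra.
Qed.

(* Moving from a point of the level set towards its nearest point of [X] changes [u] at unit speed and [v] at speed at most [k < 1]. *)
Lemma level_null (u v : E -> R) X (k : R) : X !=set0 ->
  (forall p, `|u p| = dist p X) -> lipschitz_with 1 u -> lipschitz_with k v ->
  0 <= k -> k < 1 -> leb [set p | u p + v p = 0 /\ u p <> 0] = 0%E.
Proof.
move=> X0 uX u1 vk k0 k1.
(* On each piece |u| is bounded below, so that one radius [d0] works for all its points. *)
apply: (@leb_outer_null_sub _ _ _
  (\bigcup_j [set p | u p + v p = 0 /\ j.+1%:R^-1 <= `|u p|])).
  move=> p [fp up]; exists (Num.truncn `|u p|^-1) => //; split => //.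
  have up0 : 0 < `|u p| by rewrite normr_gt0; apply/eqP.
  have /truncn_itv/andP[_ /ltW h] : 0 <= `|u p|^-1 by rewrite invr_ge0 ltW.
  by rewrite -[leRHS]invrK lef_pV2// posrE// invr_gt0.
apply: leb_outer_null_bigcup => j.
apply: (@zero_set_null (fun p => u p + v p) _ ((1 - k) / 2) j.+1%:R^-1).
- by rewrite divr_gt0// subr_gt0.
- by rewrite invr_gt0.
- move=> p q; rewrite (le_trans (lipschitzD u1 vk p q))//.
  by rewrite ler_wpM2r ?enorm_ge0//; lra.
- by move=> p [].
move=> p d [fp up] /andP[d0 dj].
have dD : d <= dist p X by rewrite -uX (le_trans dj).
(* The gain d exceeds the loss k d by (1 - k) d; half of this absorbs that the distance to X is only
   approximated, the other half remains as a lower bound for |u + v|. *)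
pose eta := (1 - k) / 2 * d.
have eta0 : 0 < eta by rewrite mulr_gt0// divr_gt0// subr_gt0.
have [|e Xe pe] := @dist_approx _ _ p X (dist p X + eta) X0.
  by rewrite ltrDl.
have De := dist_le p Xe.
set L := enorm (p - e) in pe De.
have L0 : 0 < L by lra.
have s1 : 0 <= d / L <= 1.
  apply/andP; split; first by rewrite divr_ge0// ltW.
  by rewrite ler_pdivrMr// mul1r; lra.
pose p' := p + (d / L) *: (e - p).
have pp' : enorm (p' - p) = d.
  rewrite enormB segment_enorm0 (enormB e p) -/L ger0_norm; last by case/andP: s1.
  by rewrite divfK// gt_eqF.
exists p'; first by rewrite pp'.
have p'e : enorm (p' - e) = L - d.
  rewrite segment_enorm1 (enormB e p) -/L ger0_norm; last by rewrite subr_ge0; case/andP: s1.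
  by rewrite mulrBl mul1r divfK// gt_eqF.
have h1 := dist_le p' Xe.
have h2 : `|v p' - v p| <= k * d by rewrite -pp'; exact: vk.
have h3 : `|u p| - `|u p'| <= `|u p - u p'| by exact: lerB_dist.
have h4 : `|u p - u p'| <= `|u p' + v p'| + `|v p' - v p|.
  rewrite (_ : u p - u p' = - (u p' + v p') + (v p' - v p)); last by lra.
  by rewrite (le_trans (ler_normD _ _))// normrN.
rewrite -/eta; rewrite !uX in h3; rewrite p'e in h1.
have -> : eta = d - eta - k * d by rewrite /eta; lra.
lra.
Qed.

(** Stewart's theorem on cevians, a polynomial identity in each coordinate. *)
Lemma stewart p q e (l : R) :
  enorm (p + l *: (q - p) - e) ^+ 2 =
  (1 - l) * enorm (p - e) ^+ 2 + l * enorm (q - e) ^+ 2 - l * (1 - l) * enorm (p - q) ^+ 2.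
Proof.
rewrite !sqr_enorm !mulr_sumr -big_split/= -sumrB; apply: eq_bigr => i _.
by rewrite !mxE; ring.
Qed.

(* If [q] is a deepest point of [V], moving towards [q] decreases the distance to [q] at least twice as fast as the depth in [V]. *)
Lemma equidistant_null V q : bdry V !=set0 -> (forall p, dS p V <= dS q V) ->
  leb [set p | dS p V = enorm (p - q)] = 0%E.
Proof.
move=> bV qmax.
apply: (@leb_outer_null_sub _ _ _ ([set q] `|`
  (\bigcup_j [set p | dS p V = enorm (p - q) /\ j.+1%:R^-1 <= enorm (p - q)]))).
  move=> p fp; have [->|/eqP pq] := eqVneq p q; first by left.
  right; exists (Num.truncn (enorm (p - q))^-1) => //; split => //.
  have up0 : 0 < enorm (p - q).
    rewrite lt0r enorm_ge0 andbT; apply/eqP => /enorm_eq0 h; apply: pq.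
    by apply/eqP; rewrite -subr_eq0 h.
  have /truncn_itv/andP[_ /ltW h] : 0 <= (enorm (p - q))^-1 by rewrite invr_ge0 ltW.
  by rewrite -[leRHS]invrK lef_pV2// posrE// invr_gt0.
apply: leb_outer_nullU; first exact: leb_outer_set1.
apply: leb_outer_null_bigcup => j.
apply: (@zero_set_null (fun p => dS p V + -1 * enorm (p - q)) _ 2^-1 (j.+1%:R^-1 / 2)).
- by [].
- by rewrite divr_gt0// invr_gt0.
- have := lipschitzD (dS_lipschitz bV) (lipschitzZ (-1) (lipschitz_enormB q)).
  by rewrite normrN normr1 mul1r.
- by move=> p [-> _]; rewrite mulN1r subrr.
move=> p d [fp Dj] /andP[d0 dj].
set D := enorm (p - q) in fp Dj *.
have j0 : 0 < j.+1%:R^-1 :> R by rewrite invr_gt0.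
set w := j.+1%:R^-1 in j0 Dj dj.
have D0 : 0 < D by lra.
have dD : d <= D by lra.
pose l := d / D.
have lD : l * D = d by rewrite /l divfK// gt_eqF.
have l0 : 0 < l by rewrite divr_gt0.
have l1 : l <= 1 by rewrite ler_pdivrMr// mul1r.
pose p' := p + l *: (q - p).
have p'p : enorm (p' - p) = d.
  by rewrite enormB segment_enorm0 (enormB q p) -/D ger0_norm// ltW.
have p'q : enorm (p' - q) = D - d.
  by rewrite segment_enorm1 (enormB q p) -/D ger0_norm ?subr_ge0// mulrBl mul1r lD.
exists p'; first by rewrite p'p.
(* Both p and q are at distance at least D from e, so Stewart's theorem gives |p' - e|^2 >= (1 - l
   (1 - l)) D^2, which equals (D - l D / 2)^2 + 3/4 (l D)^2. *)
have far : D - d / 2 <= dist p' (bdry V).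
  apply: dist_lb => // e be.
  have pe : D <= enorm (p - e).
    by rewrite -fp (le_trans (ler_norm _))// normr_dS dist_le.
  have qe : D <= enorm (q - e).
    by rewrite -fp (le_trans (qmax _))// (le_trans (ler_norm _))// normr_dS dist_le.
  rewrite -ler_sqr ?nnegrE ?enorm_ge0//; last by lra.
  rewrite stewart -/D -lD.
  have pe2 : D ^+ 2 <= enorm (p - e) ^+ 2 by rewrite ler_sqr// nnegrE ?enorm_ge0// ltW.
  have qe2 : D ^+ 2 <= enorm (q - e) ^+ 2 by rewrite ler_sqr// nnegrE ?enorm_ge0// ltW.
  have h1 : (1 - l) * D ^+ 2 <= (1 - l) * enorm (p - e) ^+ 2.
    by rewrite ler_wpM2l ?subr_ge0.
  have h2 : l * D ^+ 2 <= l * enorm (q - e) ^+ 2 by rewrite ler_wpM2l// ltW.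
  apply: (@le_trans _ _ ((1 - l) * D ^+ 2 + l * D ^+ 2 - l * (1 - l) * D ^+ 2)).
    have -> : (1 - l) * D ^+ 2 + l * D ^+ 2 - l * (1 - l) * D ^+ 2 =
       (D - l * D / 2) ^+ 2 + 3 / 4 * (l * D) ^+ 2 by field.
    by rewrite lerDl mulr_ge0 ?sqr_ge0.
  lra.
have h1 := dS_lipschitz bV p' p; rewrite p'p mul1r fp ler_norml in h1.
have h2 := normr_dS p' V; rewrite ger0_norm in h2; last by lra.
by rewrite p'q h2 (le_trans _ (ler_norm _))//; lra.
Qed.

(** Take the supremum of the parameters with measure at most v. Continuity from below and the null
    left jumps exclude a larger measure there; continuity from above and right continuity of the
    family exclude a smaller one. This serves distance averages and neighbourhoods alike. *)
Lemma mono_level (S : R -> set E) (a b v : R) : a <= b ->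
  (forall (x y : R), a <= x -> x <= y -> y <= b -> S x `<=` S y) ->
  (forall (x : R), a <= x <= b -> cmeas (S x)) -> bounded_set (S b) ->
  (forall (x : R) p, a <= x < b -> (forall y, x < y <= b -> S y p) -> S x p) ->
  (forall (x : R), a < x <= b ->
    leb [set p | S x p /\ forall y, a <= y < x -> ~ S y p] = 0%E) ->
  mu (S a) <= v <= mu (S b) -> exists2 x : R, a <= x <= b & mu (S x) = v.
Proof.
move=> ab Smono Smeas Sbd right left /andP[av vb].
pose T := [set x : R | a <= x <= b /\ mu (S x) <= v].
have Ta : T a by rewrite /T/= lexx.
have hsT : has_sup T by split; [exists a|exists b => x [/andP[]]].
set g := sup T.
have ag : a <= g by apply: sup_ubound Ta; case: hsT.
have gb : g <= b by apply: ge_sup; [exists a|move=> x [/andP[]]].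
have bdS (x : R) : a <= x <= b -> bounded_set (S x).
  by move=> /andP[ax xb]; apply: bounded_subset Sbd; apply: Smono.
have div1 (k : nat) (c : R) : 0 <= c -> c / k.+1%:R <= c.
  by move=> c0; rewrite ler_pdivrMr// ler_peMr// ler1n.
have div2 (k : nat) (c : R) : 0 <= c -> 0 <= c / k.+1%:R.
  by move=> c0; rewrite divr_ge0.
have div3 (k m : nat) (c : R) : 0 <= c -> (k <= m)%N -> c / m.+1%:R <= c / k.+1%:R.
  by move=> c0 km; rewrite ler_wpM2l// lef_pV2 ?posrE// ler_nat ltnS.
have div4 (c e : R) : 0 <= c -> 0 < e -> exists k, c / k.+1%:R <= e.
  move=> c0 e0; exists (Num.truncn (c / e)).
  have /truncn_itv/andP[_ /ltW] : 0 <= c / e by rewrite divr_ge0// ltW.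
  by rewrite ler_pdivrMr// => h; rewrite ler_pdivrMr// mulrC.
exists g; first by rewrite ag gb.
apply/eqP; rewrite eq_le; apply/andP; split.
  rewrite leNgt; apply/negP => vg.
  have ag' : a < g.
    by rewrite lt_neqAle ag andbT; apply/eqP => aE; move: vg; rewrite -aE ltNge av.
  have below y : a <= y -> y < g -> mu (S y) <= v.
    move=> ay yg; have [|x [/andP[ax xb] xv] yx] := @sup_adherent _ T (g - y) _ hsT.
      by rewrite subr_gt0.
    rewrite (le_trans _ xv)// le_mu//; last by apply: bdS; rewrite ax xb.
    by apply: Smono => //; move: yx; rewrite -/g; lra.
  pose y k := g - (g - a) / k.+1%:R.
  have ga0 : 0 <= g - a by lra.
  have ay k : a <= y k by rewrite /y; have := div1 k _ ga0; set c := _ / _; lra.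
  have yg k : y k < g by rewrite /y ltrBlDr ltrDl divr_gt0// subr_gt0.
  have yb k : a <= y k <= b by rewrite ay (le_trans (ltW (yg k))).
  have Uc : bounded_set (\bigcup_k S (y k)).
    apply: bounded_subset Sbd => p [k _]; apply: Smono => //.
    by rewrite (le_trans (ltW (yg k))).
  have [|||k hk] := @mu_cup_limit _ _ (fun k => S (y k)) (mu (S g) - v) _ _ Uc.
  - by move=> k; apply: Smeas.
  - move=> k m km; apply/subsetPset; apply: Smono => //.
      by rewrite lerD2l lerN2 div3.
    by rewrite (le_trans (ltW (yg m))).
  - by rewrite subr_gt0.
  have hv := below _ (ay k) (yg k).
  suff : mu (S g) <= mu (\bigcup_k S (y k)) by lra.
  have hg : a <= g <= b by rewrite ag gb.
  rewrite (mu_split (bdS _ hg) (cmeas_bigcup (fun k => Smeas _ (yb k)))).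
  rewrite (_ : mu (_ `\` _) = 0) ?addr0; first by apply: le_mu => // p [].
  apply: mu_null; apply: leb_outer_null_sub (left g _); last by rewrite ag' gb.
  move=> p [Sgp nU]; split => // x /andP[ax xg] Sx; apply: nU.
  have [|k' hk'] := div4 _ (g - x) ga0; first by rewrite subr_gt0.
  exists k' => //; apply: Smono Sx => //; first by move: hk'; rewrite /y; set c := _ / _; lra.
  by case/andP: (yb k').
rewrite leNgt; apply/negP => gv.
have gb' : g < b.
  by rewrite lt_neqAle gb andbT; apply/eqP => gE; move: gv; rewrite gE ltNge vb.
pose y k := g + (b - g) / k.+1%:R.
have bg0 : 0 <= b - g by lra.
have yb k : y k <= b by rewrite /y; have := div1 k _ bg0; set c := _ / _; lra.
have gy k : g < y k by rewrite ltrDl divr_gt0// subr_gt0.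
have ayb k : a <= y k <= b by rewrite yb (le_trans ag (ltW (gy k))).
have [||||k hk] := @mu_cap_limit _ _ (fun k => S (y k)) (v - mu (S g)).
- by move=> k; apply: Smeas.
- move=> k m km; apply/subsetPset; apply: Smono => //.
    by case/andP: (ayb m).
  by rewrite lerD2l div3.
- exact: bdS.
- by rewrite subr_gt0.
have : mu (\bigcap_k S (y k)) <= mu (S g).
  apply: le_mu; last by apply: bdS; rewrite ag gb.
  move=> p Sp; apply: right; first by rewrite ag gb'.
  move=> x /andP[gx xb]; have [|k' hk'] := div4 _ (x - g) bg0; first by rewrite subr_gt0.
  apply: (Smono (y k')) => //; first by case/andP: (ayb k').
    by move: hk'; rewrite /y; set c := _ / _; lra.
  exact: Sp.
move=> hcap; have : T (y k) by split => //; lra.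
move=> /(sup_ubound hsT.2); rewrite -/g leNgt gy.
by [].
Qed.

End level_sets.

(** * Jordan sets and the measure of the symmetric difference *)

Section jordan_sets.
Variables (R : realType) (n : nat).
Local Notation E := 'rV[R]_n.+1.
Local Notation leb := (@leb_outer R n.+1).
Implicit Types (p q e x z : E) (A B C D F X Y Z : set E).

(** Jordan measurable sets, that is, membership in J_n without regular closedness: this survives the
    intersections and differences to which [ci] is applied afterwards. *)
Definition jordan X := bounded_set X /\ mu (bdry X) = 0.

Lemma bounded_bdry X : bounded_set X -> bounded_set (bdry X).
Proof. by move=> /bounded_closure; apply: bounded_subset => p []. Qed.

Lemma jordan_null X : jordan X -> leb (bdry X) = 0%E.
Proof. by move=> [bX X0]; apply: null_mu => //; exact: bounded_bdry. Qed.

Lemma jordanI_null X : bounded_set X -> leb (bdry X) = 0%E -> jordan X.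
Proof. by move=> bX X0; split => //; exact: mu_null. Qed.

Lemma bdryU_sub A B : bdry (A `|` B) `<=` bdry A `|` bdry B.
Proof.
move=> p [cl nint]; move: cl; rewrite closureU => -[cA|cB]; [left|right].
  by split => // h; apply: nint; apply: filterS h; left.
by split => // h; apply: nint; apply: filterS h; right.
Qed.

Lemma bdryC A : bdry (~` A) = bdry A.
Proof.
suff H X : bdry (~` X) `<=` bdry X.
  by apply/seteqP; split; [exact: H|rewrite -{1}[A]setCK; exact: H].
move=> p /bdryP h; apply/bdryP => r /h[[q nXq qp] [q' Xq' qp']].
by split; [exists q' => //; exact: contrapT|exists q].
Qed.

Lemma bdryI_sub A B : bdry (A `&` B) `<=` bdry A `|` bdry B.
Proof. by rewrite -bdryC setCI -(bdryC A) -(bdryC B); exact: bdryU_sub. Qed.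

Lemma bdryD_sub A B : bdry (A `\` B) `<=` bdry A `|` bdry B.
Proof. by rewrite setDE -(bdryC B); exact: bdryI_sub. Qed.

Lemma ci_closed X : closed (ci X).
Proof. exact: closed_closure. Qed.

Lemma le_ci X Y : X `<=` Y -> ci X `<=` ci Y.
Proof. by move=> XY; apply: closure_subset; exact: interiorS. Qed.

Lemma ci_sub_closed X : closed X -> ci X `<=` X.
Proof.
move=> cX p clp; rewrite ((closure_id X).1 cX).
by apply: closure_subset clp; exact: interior_subset.
Qed.

Lemma interior_sub_ci X : interior X `<=` ci X.
Proof. exact: subset_closure. Qed.

Lemma interior_ci X : interior X `<=` interior (ci X).
Proof. by rewrite -open_subsetE; [exact: interior_sub_ci|exact: open_interior]. Qed.

Lemma ci_idem X : ci (ci X) = ci X.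
Proof.
apply/seteqP; split; first by apply: ci_sub_closed; exact: ci_closed.
by apply: closure_subset; exact: interior_ci.
Qed.

Lemma ci_sub_closure X : ci X `<=` closure X.
Proof. by apply: closure_subset; exact: interior_subset. Qed.

Lemma bdry_ci_sub X : bdry (ci X) `<=` bdry X.
Proof.
move=> p [cl ni]; split; last by move=> /interior_ci.
by apply: ci_sub_closure; rewrite -((closure_id _).1 (@ci_closed X)) in cl.
Qed.

Lemma bounded_ci X : bounded_set X -> bounded_set (ci X).
Proof. by move=> /bounded_closure; apply: bounded_subset; exact: ci_sub_closure. Qed.

Lemma jordan_sub X A B : bounded_set X -> jordan A -> jordan B ->
  bdry X `<=` bdry A `|` bdry B -> jordan X.
Proof.
move=> bX jA jB XAB; apply: jordanI_null => //.
by apply: leb_outer_null_sub XAB _; apply: leb_outer_nullU; exact: jordan_null.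
Qed.

Lemma jordanU A B : jordan A -> jordan B -> jordan (A `|` B).
Proof.
move=> jA jB; apply: (jordan_sub _ jA jB); last exact: bdryU_sub.
by apply: boundedU; [case: jA|case: jB].
Qed.

Lemma jordanI A B : jordan A -> jordan B -> jordan (A `&` B).
Proof.
move=> jA jB; apply: (jordan_sub _ jA jB); last exact: bdryI_sub.
by apply: boundedIl; case: jA.
Qed.

Lemma jordanD A B : jordan A -> jordan B -> jordan (A `\` B).
Proof.
move=> jA jB; apply: (jordan_sub _ jA jB); last exact: bdryD_sub.
by apply: boundedD; case: jA.
Qed.

Lemma jordan_ci X : jordan X -> jordan (ci X).
Proof.
move=> jX; apply: (jordan_sub _ jX jX); first by apply: bounded_ci; case: jX.
by rewrite setUid; exact: bdry_ci_sub.
Qed.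

Lemma jordan_cmeas X : jordan X -> cmeas X.
Proof.
move=> jX.
have -> : X = interior X `|` (X `\` interior X).
  by rewrite setDUK//; exact: interior_subset.
apply: cmeasU; first by apply: cmeas_open; exact: open_interior.
apply: cmeas_null; apply: leb_outer_null_sub (jordan_null jX).
by move=> p [Xp nip]; split => //; exact: subset_closure.
Qed.

Lemma Jn_jordan X : Jn X -> jordan X.
Proof. by move=> [bX [_ X0]]. Qed.

Lemma Jn_ci X : jordan X -> Jn (ci X).
Proof. by move=> jX; have [bX X0] := jordan_ci jX; split => //; rewrite ci_idem. Qed.

Lemma Jn_eq X : Jn X -> X = ci X.
Proof. by case=> _ []. Qed.

Lemma Jn_closed X : Jn X -> closed X.
Proof. by move=> /Jn_eq ->; exact: ci_closed. Qed.

Lemma Jn_bounded X : Jn X -> bounded_set X.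
Proof. by case. Qed.

Lemma Jn_cmeas X : Jn X -> cmeas X.
Proof. by move=> /Jn_closed; exact: cmeas_closed. Qed.

Lemma JnU A B : Jn A -> Jn B -> Jn (A `|` B).
Proof.
move=> jA jB; have [bU U0] := jordanU (Jn_jordan jA) (Jn_jordan jB).
split => //; split => //; apply/seteqP; split.
  move=> p [|]; first by rewrite {1}(Jn_eq jA); apply: le_ci; left.
  by rewrite {1}(Jn_eq jB); apply: le_ci; right.
by apply: ci_sub_closed; apply: closedU; exact: Jn_closed.
Qed.

Lemma Jn0 : Jn (set0 : set E).
Proof.
have bd0 : bdry (set0 : set E) = set0 by rewrite /bdry closure0 set0D.
split; first by exists 0.
by split; [rewrite /ci interior0 closure0|rewrite bd0 mu_set0].
Qed.

(** O \ Z is open, hence empty if null. This turns equality of measures of nested sets into equality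
    of their [ci]. *)
Lemma open_sub_closed_null O Z : open O -> closed Z -> leb (O `\` Z) = 0%E ->
  O `<=` Z.
Proof.
move=> oO cZ OZ0 p Op; apply: contrapT => nZp.
have : (0 < leb (O `\` Z))%E.
  apply: leb_outer_open_gt0; last by exists p.
  by rewrite setDE; apply: openI => //; exact: closed_openC.
by rewrite OZ0 ltxx.
Qed.

Lemma ci_eq_closed X Y : X `<=` Y -> closed X -> leb (Y `\` X) = 0%E -> ci X = ci Y.
Proof.
move=> XY cX YX0; apply/seteqP; split; first exact: le_ci.
suff : interior Y `<=` X.
  by rewrite open_subsetE; [exact: closure_subset|exact: open_interior].
apply: open_sub_closed_null => //; first exact: open_interior.
by apply: leb_outer_null_sub YX0 => p [/interior_subset].
Qed.

(** For sets that need not be closed, such as a neighbourhood cut by [V]: the points of X outside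
    [ci X] are boundary points and form a null set. *)
Lemma ci_eq_jordan X Y : X `<=` Y -> jordan X -> leb (Y `\` X) = 0%E -> ci X = ci Y.
Proof.
move=> XY jX YX0; apply/seteqP; split; first exact: le_ci.
suff : interior Y `<=` ci X.
  by move=> /closure_subset; rewrite -((closure_id (ci X)).1 (@ci_closed X)).
apply: open_sub_closed_null; [exact: open_interior|exact: ci_closed|].
apply: leb_outer_null_sub (leb_outer_nullU YX0 (jordan_null jX)).
move=> p [iYp nci]; have [Xp|nXp] := pselect (X p); [right|left].
  split; first exact: subset_closure.
  by move/interior_sub_ci.
by split => //; exact: interior_subset.
Qed.

Lemma dmu_ge0 A B : 0 <= dmu A B.
Proof. exact: mu_ge0. Qed.

Lemma dmuC A B : dmu A B = dmu B A.
Proof. by rewrite /dmu setUC. Qed.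

Lemma dmu_xx A : dmu A A = 0.
Proof. by rewrite /dmu setDv setU0 mu_set0. Qed.

Lemma dmu_sub A B : A `<=` B -> dmu A B = mu (B `\` A).
Proof. by move=> AB; rewrite /dmu (_ : A `\` B = set0) ?set0U// setD_eq0. Qed.

Lemma bounded_symdiff A B : bounded_set A -> bounded_set B ->
  bounded_set ((A `\` B) `|` (B `\` A)).
Proof. by move=> bA bB; apply: boundedU; exact: boundedD. Qed.

(** Reduces subadditivity of [dmu] under set operations to propositional logic about a single
    point. *)
Lemma dmu_le_add A B C D F X : bounded_set C -> bounded_set D ->
  bounded_set F -> bounded_set X ->
  (forall p, (A p /\ ~ B p) \/ (B p /\ ~ A p) ->
    ((C p /\ ~ D p) \/ (D p /\ ~ C p)) \/ ((F p /\ ~ X p) \/ (X p /\ ~ F p))) ->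
  dmu A B <= dmu C D + dmu F X.
Proof.
move=> bC bD bF bX h.
apply: le_trans (mu_setU_le (bounded_symdiff bC bD) (bounded_symdiff bF bX)).
by apply: le_mu; [move=> p /h|apply: boundedU; exact: bounded_symdiff].
Qed.

Lemma dmu_triangle A B C : bounded_set A -> bounded_set B -> bounded_set C ->
  dmu A C <= dmu A B + dmu B C.
Proof.
move=> bA bB bC; apply: dmu_le_add => // p.
by have := lem (B p); tauto.
Qed.

Lemma dmuU A B C D : bounded_set A -> bounded_set B -> bounded_set C ->
  bounded_set D -> dmu (A `|` B) (C `|` D) <= dmu A C + dmu B D.
Proof. by move=> *; apply: dmu_le_add => // p; rewrite /setU/=; tauto. Qed.

Lemma dmuI A B C D : bounded_set A -> bounded_set B -> bounded_set C ->
  bounded_set D -> dmu (A `&` B) (C `&` D) <= dmu A C + dmu B D.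
Proof.
move=> *; apply: dmu_le_add => // p; rewrite /setI/=.
by have := lem (A p); have := lem (B p); have := lem (C p); have := lem (D p); tauto.
Qed.

Lemma dmuD A B X : bounded_set A -> bounded_set B ->
  dmu (A `\` X) (B `\` X) <= dmu A B.
Proof.
move=> bA bB; apply: le_mu; last exact: bounded_symdiff.
by move=> p; rewrite /setU/setD/=; have := lem (X p); tauto.
Qed.

Lemma mu_dmu A B : bounded_set A -> bounded_set B -> `|mu A - mu B| <= dmu A B.
Proof.
move=> bA bB.
have H X Y : bounded_set X -> bounded_set Y -> mu X <= mu Y + dmu X Y.
  move=> bX bY; apply: le_trans (mu_setU_le bY (bounded_symdiff bX bY)).
  apply: le_mu; last by apply: boundedU => //; exact: bounded_symdiff.
  by move=> p Xp; rewrite /setU/setD/=; have := lem (Y p); tauto.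
have := H A B bA bB; have := H B A bB bA; rewrite (dmuC B A) ler_norml => ? ?.
by apply/andP; split; lra.
Qed.

Lemma dmu0_mu A B : bounded_set A -> bounded_set B -> dmu A B = 0 -> mu A = mu B.
Proof.
move=> bA bB AB0; have := mu_dmu bA bB; rewrite AB0 normr_le0 subr_eq0.
by move/eqP.
Qed.

Lemma dmu_ci X : jordan X -> dmu X (ci X) = 0.
Proof.
move=> jX; apply: mu_null; apply: leb_outer_null_sub (jordan_null jX).
move=> p [[Xp nc]|[cp nX]].
  by split; [exact: subset_closure|move=> /interior_sub_ci].
by split; [exact: ci_sub_closure|move=> /interior_subset].
Qed.

Lemma mu_ci X : jordan X -> mu (ci X) = mu X.
Proof.
move=> jX; apply/esym/dmu0_mu; last exact: dmu_ci.
  by case: jX.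
by apply: bounded_ci; case: jX.
Qed.

End jordan_sets.

(** * Simply different sets *)

Section profile.
Variables (R : realType) (n : nat).
Local Notation E := 'rV[R]_n.+1.
Local Notation leb := (@leb_outer R n.+1).
Implicit Types (p q e : E) (A B V : set E).

Lemma compact_closed_bounded A : closed A -> bounded_set A -> compact A.
Proof.
move=> cA [M AM].
have Mnco : compact [set v : E | forall i, v ord0 i \in `[(- M), M]].
  apply: (@rV_compact _  _ (fun=> `[(- M), M]%classic)).
  by move=> _; apply: segment_compact.
apply: subclosed_compact cA Mnco _ => v /AM vM i.
by rewrite in_itv/= -ler_norml (le_trans (coord_le_enorm _ _)).
Qed.

(** [V] may fail to be closed, so the maximum is taken over its closure. A positive maximum is
    attained in the interior of [V]; otherwise every point of [V] has depth 0 and is a maximizer. *)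
Lemma deepest_point V : V !=set0 -> bounded_set V ->
  exists q, V q /\ forall p, dS p V <= dS q V.
Proof.
move=> V0 bV; have bd := bdry_nonempty V0 bV.
have outV p : ~ V p -> dS p V <= 0 by move=> nV; rewrite dS_out// oppr_le0 dist_ge0.
have clV0 : closure V !=set0 by case: V0 => v Vv; exists v; exact: subset_closure.
have [||q cq qmax] := @EVT_max_rV R n.+1 (fun p => dS p V) (closure V) clV0.
- by apply: compact_closed_bounded; [exact: closed_closure|exact: bounded_closure].
- by apply: continuous_subspaceT; apply: lipschitz_continuous (dS_lipschitz bd).
have [q0|q0] := ltP 0 (dS q V).
  exists q; split; first by apply: interior_subset; apply/(dS_gt0 q bd).
  move=> p; have [Vp|nVp] := pselect (V p).
    by apply: qmax; rewrite inE; exact: subset_closure.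
  exact: le_trans (outV _ nVp) (ltW q0).
have [v Vv] := V0; exists v; split => // p.
have v0 : 0 <= dS v V by rewrite dS_in// dist_ge0.
have [Vp|/outV/le_trans] := pselect (V p); last exact.
by apply: le_trans v0; apply: le_trans q0; apply: qmax; rewrite inE; exact: subset_closure.
Qed.

(* For [B] empty the distance average treats [B] as the single point [qs V]. *)
Lemma davg_profile (qs : set E -> E) V B : centre_selector qs -> Jn B ->
  B `<=` V -> V !=set0 -> bounded_set V ->
  exists b : E -> R, exists Z : set E,
  [/\ forall x p, dfun qs x V B p = x * dS p V + (1 - x) * b p,
      Z !=set0, forall p, `|b p| = dist p Z, lipschitz_with 1 b &
      [/\ forall p, b p <= dS p V, leb [set p | b p = 0] = 0%E,
        ci [set p | 0 <= b p] = B, mu [set p | 0 <= b p] = mu B &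
        B = set0 -> leb [set p | dS p V + b p = 0] = 0%E]].
Proof.
move=> qsP JB BV V0 bV; have bdV := bdry_nonempty V0 bV.
have [B0|nB0] := pselect (B !=set0).
  have bdB := bdry_nonempty B0 (Jn_bounded JB).
  have cB : [set p | 0 <= dS p B] = B.
    rewrite [RHS]((closure_id _).1 (Jn_closed JB)).
    by apply/seteqP; split => p /=; rewrite dS_ge0.
  exists (fun p => dS p B), (bdry B); split => //.
  - by move=> x p; rewrite /dfun !asboolT.
  - by move=> p; exact: normr_dS.
  - exact: dS_lipschitz.
  - split.
    + by move=> p; exact: le_dS.
    + apply: leb_outer_null_sub (jordan_null (Jn_jordan JB)).
      by move=> p /= /(dS_eq0 p bdB).
    + by rewrite cB -(Jn_eq JB).
    + by rewrite cB.
    + by move=> B0'; case: B0 => p; rewrite B0'.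
have BE : B = set0 by apply/seteqP; split => // p Bp; apply: nB0; exists p.
have [q0 [Vq0 q0max]] := deepest_point V0 bV.
have [Vq qmax'] : V (qs V) /\ forall p, V p -> dS p V <= dS (qs V) V.
  by apply: qsP; exists q0; split => // p _; exact: q0max.
set q := qs V in Vq qmax'.
have qmax p : dS p V <= dS q V by apply: le_trans (q0max p) (qmax' _ Vq0).
have q1 : [set q] !=set0 by exists q.
have zero p : (- enorm (p - q) = 0) <-> p = q.
  split=> [/eqP|->]; last by rewrite subrr enorm0 oppr0.
  by rewrite oppr_eq0 => /eqP/enorm_eq0/eqP; rewrite subr_eq0 => /eqP.
have ge0 : [set p | 0 <= - enorm (p - q)] = [set q].
  apply/seteqP; split => p /=.
    by move=> h; apply/zero/eqP; rewrite eq_le h andbT oppr_le0 enorm_ge0.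
  by move=> ->; rewrite subrr enorm0 oppr0.
exists (fun p => - enorm (p - q)), [set q]; split => //.
- by move=> x p; rewrite /dfun asboolT// asboolF// -/q mulrN -mulNr opprB.
- move=> p; rewrite normrN ger0_norm ?enorm_ge0//; apply/eqP; rewrite eq_le.
  by rewrite (@dist_le _ _ p [set q] q)// andbT; apply: dist_lb => // e ->.
- move=> x y; rewrite -opprD normrN; exact: lipschitz_enormB.
- split.
  + move=> p; have [Vp|nVp] := pselect (V p).
      by rewrite dS_in// (@le_trans _ _ 0) ?dist_ge0// oppr_le0 enorm_ge0.
    have [z bz zE] := bdry_crossing Vq nVp.
    rewrite dS_out// lerN2 (le_trans (dist_le p bz))//.
    by rewrite (enormB p z) (enormB p q) -zE lerDr enorm_ge0.
  + by apply: leb_outer_null_sub (leb_outer_set1 q) => p /= /zero.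
  + rewrite ge0 BE; apply/seteqP; split => //.
    have -> : ci [set q] = closure set0; last by rewrite closure0.
    congr closure; apply/seteqP; split => //.
    apply: open_sub_closed_null; [exact: open_interior|exact: closed0|].
    by apply: leb_outer_null_sub (leb_outer_set1 q) => p [/interior_subset].
  + by rewrite ge0 BE mu_set0; apply: mu_null; exact: leb_outer_set1.
  + move=> _; apply: leb_outer_null_sub (equidistant_null bdV qmax).
    by move=> p /= /eqP; rewrite subr_eq0 => /eqP.
Qed.

End profile.

(** * The Step 1 averages *)

Section step_one.
Variables (R : realType) (n : nat).
Local Notation E := 'rV[R]_n.+1.
Local Notation leb := (@leb_outer R n.+1).
Implicit Types (p q e : E).
Variables (qs : set E -> E) (N : R) (V B : set E).
(* [V] will be [B] together with a union of components of [A \ B]: it need not be closed, which is why only [jordan V] and [clV] are assumed. *)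
Hypotheses (N1 : 1 <= N) (qsP : centre_selector qs) (JB : Jn B) (BV : B `<=` V)
  (JV : jordan V) (V0 : V !=set0) (clV : interior (closure V) `<=` interior V).

Let N0 : 0 <= N.
Proof. exact: le_trans ler01 N1. Qed.

Let Nle0 : - N <= 0.
Proof. by rewrite oppr_le0. Qed.

Let NleN : - N <= N.
Proof. exact: le_trans Nle0 N0. Qed.

Let Nle1 : - N <= 1.
Proof. exact: le_trans Nle0 ler01. Qed.

Let bV : bounded_set V := JV.1.
Let bdV : bdry V !=set0 := bdry_nonempty V0 bV.

Let a p := dS p V.
(** To be thought of as the signed distance of [B], or as minus the distance to the centre when [B]
    is empty; it is used only through [bP]. *)
Let b : E -> R := sval (cid (davg_profile qsP JB BV V0 bV)).
Let Z : set E := sval (cid (svalP (cid (davg_profile qsP JB BV V0 bV)))).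

Let bP : [/\ forall x p, dfun qs x V B p = x * a p + (1 - x) * b p,
      Z !=set0, forall p, `|b p| = dist p Z, lipschitz_with 1 b &
      [/\ forall p, b p <= a p, leb [set p | b p = 0] = 0%E,
        ci [set p | 0 <= b p] = B, mu [set p | 0 <= b p] = mu B &
        B = set0 -> leb [set p | a p + b p = 0] = 0%E]].
Proof. exact: (svalP (cid (svalP (cid (davg_profile qsP JB BV V0 bV))))). Qed.

Let f x p := x * a p + (1 - x) * b p.
Let D x := davg qs x V B.

Let DE x : D x = [set p | 0 <= f x p].
Proof. by rewrite /D /davg; apply/seteqP; split => p /=; case: bP => ->. Qed.

Let b_le_a p : b p <= a p.
Proof. by case: bP => _ _ _ _ []. Qed.

Let a_lip : lipschitz_with 1 a := dS_lipschitz bdV.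
Let b_lip : lipschitz_with 1 b.
Proof. by case: bP. Qed.

Let f_cont x : continuous (f x).
Proof.
exact: lipschitz_continuous (lipschitzD (lipschitzZ x a_lip) (lipschitzZ (1 - x) b_lip)).
Qed.

Let D_closed x : closed (D x).
Proof. by rewrite DE; apply: closed_ge_continuous. Qed.

Let D_mono x y : x <= y -> D x `<=` D y.
Proof.
rewrite !DE => xy p /= h; rewrite (le_trans h)// /f -subr_ge0.
have -> : y * a p + (1 - y) * b p - (x * a p + (1 - x) * b p) = (y - x) * (a p - b p) by ring.
by rewrite mulr_ge0// subr_ge0.
Qed.

(** For y >= 1, f is a + (y - 1) (a - b). Here a is at most M - |p|, and this decay also cancels the
    growth of -b, so a - b stays bounded above and f is negative far away. *)
Let D_bounded x : bounded_set (D x).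
Proof.
apply: (@bounded_subset _ _ _ (D (Num.max x 1))).
  by apply: D_mono; rewrite le_max lexx.
set y := Num.max x 1.
have y1 : 1 <= y by rewrite le_max lexx orbT.
have [M aM] := dS_decay bdV bV.
exists (M + (y - 1) * (M - b 0)) => p; rewrite DE /= /f => h.
have h1 : b 0 - b p <= enorm p.
  have := b_lip 0 p; rewrite sub0r enormN mul1r; apply: le_trans.
  exact: ler_norm.
have h2 := aM p; rewrite -/(a p) in h2.
have h3 : (y - 1) * (a p - b p) <= (y - 1) * (M - b 0).
  by rewrite ler_wpM2l ?subr_ge0//; lra.
lra.
Qed.

Let good x := leb [set p | f x p = 0] = 0%E.

Let good_neq_half x : x != 2^-1 -> good x.
Proof.
move=> x2; case: bP => _ Z0 bZ _ [_ nb _ _ _].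
have na : leb [set p | a p = 0] = 0%E.
  by apply: leb_outer_null_sub (jordan_null JV) => p /= /(dS_eq0 p bdV).
have [xlt|xgt|/eqP] := ltgtP x 2^-1; last by rewrite (negbTE x2).
- have x1 : 0 < 1 - x by lra.
  (* Dividing by the dominant coefficient leaves the other function with constant |k|, and x < 1/2
     gives |k| < 1, for negative x as well. *)
  pose k := x / (1 - x).
  have k1 : `|k| < 1.
    by rewrite normrM normfV (gtr0_norm x1) ltr_pdivrMr// mul1r ltr_norml; lra.
  have := level_null Z0 bZ b_lip (lipschitzZ k a_lip).
  rewrite mulr1 => /(_ (normr_ge0 _) k1) h.
  apply: leb_outer_null_sub (leb_outer_nullU nb h) => p /= fp.
  have [b0|/eqP b0] := eqVneq (b p) 0; [by left|right; split => //].
  apply: (@mulfI _ (1 - x)); first by rewrite gt_eqF.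
  rewrite mulr0 mulrDr /k mulrA mulrCA divff ?mulr1 ?gt_eqF// addrC; exact: fp.
- have x0 : 0 < x by lra.
  pose k := (1 - x) / x.
  have k1 : `|k| < 1.
    by rewrite normrM normfV (gtr0_norm x0) ltr_pdivrMr// mul1r ltr_norml; lra.
  have := level_null (bdV) (fun p => normr_dS p V) a_lip (lipschitzZ k b_lip).
  rewrite mulr1 => /(_ (normr_ge0 _) k1) h.
  apply: leb_outer_null_sub (leb_outer_nullU na h) => p /= fp.
  have [b0|/eqP b0] := eqVneq (a p) 0; [by left|right; split => //].
  apply: (@mulfI _ x); first by rewrite gt_eqF.
  rewrite mulr0 mulrDr /k mulrA mulrCA divff ?mulr1 ?gt_eqF//; exact: fp.
Qed.

Let zero_condE : zero_measure_cond qs V B <-> good 2^-1.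
Proof.
rewrite /zero_measure_cond.
have -> : [set p | dfun qs 2^-1 V B p = 0] = [set p | f 2^-1 p = 0].
  by apply/seteqP; split => p /=; case: bP => ->.
split=> [h|]; last exact: mu_null.
apply: null_mu h; apply: bounded_subset (D_bounded 2^-1) => p /= fp.
by rewrite DE /= fp.
Qed.

Let good_set0 : B = set0 -> good 2^-1.
Proof.
case: bP => _ _ _ _ [_ _ _ _ h] /h; apply: leb_outer_null_sub => p /=.
rewrite /f => h1; lra.
Qed.

Let D_jordan x : good x -> jordan (D x).
Proof.
move=> gx; apply: jordanI_null => //; apply: leb_outer_null_sub gx => p [].
rewrite -((closure_id _).1 (@D_closed x)) DE /= => fp nint.
apply/eqP; rewrite eq_le fp andbT leNgt; apply/negP => fp0; apply: nint.
have oP : open [set q | 0 < f x q].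
  by apply: open_comp (@open_gt _ 0) => q _; exact: f_cont.
by apply: filterS (open_nbhs_nbhs (conj oP fp0)) => q /ltW.
Qed.

Let h x := mu (D x).

Let h_mono x y : x <= y -> h x <= h y.
Proof. by move=> xy; apply: le_mu => //; exact: D_mono. Qed.

Let D0 : D 0 = [set p | 0 <= b p].
Proof. by rewrite DE; apply/seteqP; split => p /=; rewrite /f mul0r add0r subr0 mul1r. Qed.

Let D1 : D 1 = closure V.
Proof.
rewrite DE; apply/seteqP; split => p /=; rewrite /f subrr mul0r addr0 mul1r /a.
  by move/(dS_ge0 p bdV).
by move=> ?; apply/dS_ge0.
Qed.

Let h0 : h 0 = mu B.
Proof. by rewrite /h D0; case: bP => _ _ _ _ []. Qed.

Let ciD0 : ci (D 0) = B.
Proof. by rewrite D0; case: bP => _ _ _ _ []. Qed.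

Let h1 : h 1 = mu V.
Proof.
rewrite /h D1; apply: dmu0_mu => //; first exact: bounded_closure.
rewrite dmuC dmu_sub; last exact: subset_closure.
apply: mu_null; apply: leb_outer_null_sub (jordan_null JV) => p [cp nV].
by split => // /interior_subset.
Qed.

Let ciD1 : ci (D 1) = ci V.
Proof.
rewrite D1; apply/seteqP; split; first exact: closure_subset.
by apply: le_ci; exact: subset_closure.
Qed.

(** A minimizer is known only through its measure. If g' < g, the hypothesis forces D g' to fill D g
    up to a null set, and both have the same [ci]. *)
Let ci_D_le g g' : h g <= h g' -> ci (D g) `<=` ci (D g').
Proof.
have [gg' _|gg'] := leP g g'; first by apply: le_ci; exact: D_mono.
move=> hh; rewrite (_ : ci (D g) = ci (D g'))//; apply/esym.
apply: ci_eq_closed => //; first exact/D_mono/ltW.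
apply: null_mu; first exact: boundedD.
rewrite mu_setD//; [|exact: cmeas_closed|exact/D_mono/ltW].
by apply/eqP; rewrite subr_eq0 eq_le hh h_mono// ltW.
Qed.

Let target t := t * mu V + (1 - t) * mu B.
Let clamp v := Num.min (Num.max v (h (- N))) (h N).

Let hN x : - N <= x <= N -> h (- N) <= h x <= h N.
Proof. by move=> /andP[? ?]; rewrite !h_mono. Qed.

(** For fixed p, f x p is affine in x with slope a p - b p >= 0. So membership in D x is right
    continuous in x, and a point that enters only at x satisfies f x p = 0, a null condition for
    good x. *)
Let clamp_attained (al be v : R) : - N <= al -> al <= be -> be <= N ->
  (forall x, al <= x <= be -> good x) -> h al <= clamp v <= h be ->
  exists2 g, - N <= g <= N /\ good g & h g = clamp v.
Proof.
move=> Nal albe beN gd cv.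
have [||||||g /[dup] gab /andP[g1 g2] hg] := @mono_level _ _ D al be (clamp v) albe.
- by move=> x y _ xy _; exact: D_mono.
- by move=> x _; exact: cmeas_closed.
- exact: D_bounded.
- move=> x p /andP[ax xb] Dp; rewrite DE /=.
  rewrite leNgt; apply/negP => fx.
  have ab0 : 0 <= a p - b p by rewrite subr_ge0.
  have fy y : f y p = f x p + (y - x) * (a p - b p) by rewrite /f; ring.
  (* Small enough to keep f negative at x + d; the added 1 avoids a zero denominator. *)
  pose d := Num.min (be - x) (- f x p / (2 * (a p - b p + 1))).
  have k0 : 0 < 2 * (a p - b p + 1) by rewrite mulr_gt0// ltr_wpDl.
  have d0 : 0 < d by rewrite lt_min subr_gt0 xb/= divr_gt0// oppr_gt0.
  have dle : d <= be - x by rewrite ge_min lexx.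
  have dk : d * (2 * (a p - b p + 1)) <= - f x p.
    by rewrite -ler_pdivlMr// ge_min lexx orbT.
  have := Dp (x + d); rewrite DE /= fy.
  have -> : x + d - x = d by lra.
  have -> : x < x + d <= be by apply/andP; split; lra.
  move=> /(_ isT); nra.
- move=> x /andP[ax xb]; have gx : good x by apply: gd; rewrite xb ltW.
  apply: leb_outer_null_sub gx => p /= [Dx nD].
  rewrite DE /= in Dx; apply/eqP; rewrite eq_le Dx andbT leNgt; apply/negP => fx.
  have ab0 : 0 <= a p - b p by rewrite subr_ge0.
  have fy y : f y p = f x p + (y - x) * (a p - b p) by rewrite /f; ring.
  pose d := Num.min (x - al) (f x p / (a p - b p + 1)).
  have k0 : 0 < a p - b p + 1 by rewrite ltr_wpDl.
  have d0 : 0 < d by rewrite lt_min subr_gt0 ax/= divr_gt0.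
  have dle : d <= x - al by rewrite ge_min lexx.
  have dk : d * (a p - b p + 1) <= f x p.
    by rewrite -ler_pdivlMr// ge_min lexx orbT.
  apply: (nD (x - d)); first by apply/andP; split; lra.
  rewrite DE /= fy; nra.
- exact: cv.
exists g => //; split; last exact: gd.
by rewrite (le_trans Nal g1) (le_trans g2 beN).
Qed.

Let min_prop v g := - N <= g <= N /\ forall xi : R, - N <= xi <= N ->
  `|h g - v| <= `|h xi - v|.

(** On [-N,N] the values of h lie in [h(-N), h(N)], where the clamped value is the unique nearest
    point to v. Once it is attained, every minimizer attains it, whichever one [get] returns. *)
Let minimizer_get v : (exists2 g, - N <= g <= N /\ good g & h g = clamp v) ->
  exists2 g, min_prop v g & forall g', min_prop v g' -> h g' = clamp v.
Proof.
move=> [g [gN gg] hg].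
have NN : h (- N) <= h N. exact/h_mono/NleN.
have cl x : h (- N) <= x <= h N -> `|clamp v - v| <= `|x - v| /\
    (`|x - v| <= `|clamp v - v| -> x = clamp v).
  move=> /andP[x1 x2]; rewrite /clamp.
  have [v1|v1] := leP v (h (- N)).
    rewrite min_l// !ger0_norm ?subr_ge0//; last exact: le_trans x1.
    by split => [|hx]; [lra|apply/eqP; rewrite eq_le; apply/andP; split; lra].
  have [v2|v2] := leP v (h N).
    rewrite subrr normr0; split => //; rewrite normr_le0 subr_eq0 => /eqP //.
  rewrite distrC (distrC x) !ger0_norm ?subr_ge0; [|lra|lra].
  by split => [|hx]; [lra|apply/eqP; rewrite eq_le; apply/andP; split; lra].
exists g.
  by split => // xi /hN /cl[]; rewrite hg.
move=> g' [g'N g'min]; apply: (cl _ (hN g'N)).2.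
by rewrite -hg; exact: g'min.
Qed.

Let mu_BV : mu B <= mu V.
Proof. exact: le_mu. Qed.

Let target_mono s t : s <= t -> target s <= target t.
Proof.
move=> st; rewrite /target -subr_ge0.
have -> : t * mu V + (1 - t) * mu B - (s * mu V + (1 - s) * mu B) =
  (t - s) * (mu V - mu B) by ring.
by rewrite mulr_ge0 ?subr_ge0.
Qed.

Let target0 : target 0 = h 0.
Proof. by rewrite h0 /target mul0r add0r subr0 mul1r. Qed.

Let target1 : target 1 = h 1.
Proof. by rewrite h1 /target mul1r subrr mul0r addr0. Qed.

Let clamp_id t : 0 <= t <= 1 -> clamp (target t) = target t.
Proof.
move=> /andP[t0 t1]; rewrite /clamp max_l ?min_l//.
  by rewrite (le_trans (target_mono t1))// target1 h_mono.
by apply: le_trans (target_mono t0); rewrite target0; apply: h_mono; rewrite oppr_le0 (le_trans ler01).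
Qed.

Let clamp_mono u v : u <= v -> clamp u <= clamp v.
Proof. by move=> uv; rewrite /clamp le_min2 ?le_max2. Qed.

Let clamp_bounds v : h (- N) <= clamp v <= h N.
Proof.
have NN : h (- N) <= h N. exact/h_mono/NleN.
by rewrite /clamp ge_min lexx orbT andbT le_min le_max lexx orbT NN.
Qed.

Let davg_attained t : good 2^-1 \/ ~ (0 <= t <= 1) ->
  exists2 g, - N <= g <= N /\ good g & h g = clamp (target t).
Proof.
move=> [g2|tn].
  apply: (@clamp_attained (- N) N) => //.
  move=> x _; have [->//|] := eqVneq x 2^-1; exact: good_neq_half.
have [t0|t0] := leP 0 t; last first.
  apply: (@clamp_attained (- N) 0) => //.
    move=> x xN; apply: good_neq_half; apply/eqP => x2; move: xN; rewrite x2 => /andP[? ?]; lra.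
  have /andP[-> _] := clamp_bounds (target t).
  rewrite /= -target0 -[leRHS]clamp_id ?lexx ?ler01//.
  by apply/clamp_mono/target_mono/ltW.
have t1 : 1 < t.
  by rewrite ltNge; apply/negP => t1; apply: tn; rewrite t0.
apply: (@clamp_attained 1 N) => //.
  move=> x xN; apply: good_neq_half; apply/eqP => x2; move: xN; rewrite x2 => /andP[? ?]; lra.
have /andP[_ ->] := clamp_bounds (target t).
rewrite /= andbT -target1 -[leLHS]clamp_id ?lexx ?ler01//.
by apply/clamp_mono/target_mono/ltW.
Qed.

Let X r := Onbhd B r `&` V.

Let X_mono r s : r <= s -> X r `<=` X s.
Proof. by move=> rs p [Or Vp]; split => //; exact: le_trans rs. Qed.

Let O_closed r : B !=set0 -> closed (Onbhd B r).
Proof.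
move=> B0; apply: closed_le_continuous.
exact: lipschitz_continuous (dist_lipschitz B0).
Qed.

(** The case of [level_null] in which the second function is constant and k = 0. *)
Let dist_null r : B !=set0 -> 0 < r -> leb [set p | dist p B = r] = 0%E.
Proof.
move=> B0 r0.
have l0 : lipschitz_with 0 (fun _ : E => - r) by move=> p q; rewrite mul0r subrr normr0.
have := @level_null _ _ (fun p => dist p B) (fun _ : E => - r) B 0 B0 _ (dist_lipschitz B0) l0 (lexx _) ltr01.
have dB p : `|dist p B| = dist p B by rewrite ger0_norm// dist_ge0.
move=> /(_ dB); apply: leb_outer_null_sub => p /= ->; split; first by rewrite subrr.
by apply/eqP; rewrite gt_eqF.
Qed.

Let O0 : B !=set0 -> Onbhd B 0 = B.
Proof.
move=> B0; rewrite [RHS]((closure_id _).1 (Jn_closed JB)).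
apply/seteqP; split => p /=.
  by rewrite /Onbhd/= => h'; apply/dist_eq0 => //; apply/eqP; rewrite eq_le h' dist_ge0.
by rewrite /Onbhd/= => /(dist_eq0 p B0) ->.
Qed.

Let X0 : B !=set0 -> X 0 = B.
Proof. by move=> B0; rewrite /X O0//; apply/seteqP; split => [p []//|p Bp]; split => //; exact: BV. Qed.

Let X_jordan r : B !=set0 -> 0 <= r -> jordan (X r).
Proof.
move=> B0; rewrite le_eqVlt => /orP[/eqP <-|r0]; first by rewrite X0//; exact: Jn_jordan.
apply: jordanI_null; first exact: boundedIr.
apply: leb_outer_null_sub (leb_outer_nullU (dist_null B0 r0) (jordan_null JV)).
move=> p /bdryI_sub[[clO nint]|]; [left|by right].
rewrite -((closure_id _).1 (@O_closed r B0)) in clO.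
apply/eqP; rewrite eq_le [_ <= r]clO leNgt; apply/negP => pr; apply: nint.
have oP : open [set q | dist q B < r].
  have cd : continuous (fun q => dist q B).
    exact: lipschitz_continuous (dist_lipschitz B0).
  by apply: (@open_comp _ _ (fun q => dist q B) [set x | x < r]) => // q _; exact: cd.
by apply: filterS (open_nbhs_nbhs (conj oP pr)) => q /ltW.
Qed.

Let Onbhd_attained t : B !=set0 -> 0 <= t <= 1 ->
  exists r, 0 <= r /\ mu (X r) = target t.
Proof.
move=> B0 /andP[t0 t1]; have [e Be] := B0; have [M VM] := bV.
(* Large enough for the ball of this radius about the point e of B to contain V. *)
pose rM := `|M| + enorm e.
have rM0 : 0 <= rM by rewrite addr_ge0// enorm_ge0.
have XM : X rM = V.
  apply/seteqP; split => [p []//|p Vp]; split => //; rewrite /Onbhd/=.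
  rewrite (le_trans (dist_le p Be))// (le_trans (ler_enormD _ _))// enormN lerD2r.
  by rewrite (le_trans (VM _ Vp))// ler_norm.
have [||||||r /andP[r0 _] hr] := @mono_level _ _ X 0 rM (target t) rM0.
- by move=> x y _ xy _; exact: X_mono.
- by move=> x _; apply: cmeasI; [exact/cmeas_closed/O_closed|exact: jordan_cmeas].
- exact: boundedIr.
- move=> x p /andP[x0 xM] Xp; split; last by case: (Xp rM); rewrite ?xM ?lexx.
  rewrite /Onbhd/= leNgt; apply/negP => xp.
  pose y := Num.min rM ((x + dist p B) / 2).
  have yd : y <= (x + dist p B) / 2 by rewrite ge_min lexx orbT.
  have [] := Xp y; last by rewrite /Onbhd/= => yp _; lra.
  by rewrite lt_min xM ge_min lexx /= andbT; lra.
- move=> x /andP[x0 xM]; apply: leb_outer_null_sub (dist_null B0 x0) => p /=.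
  move=> [[Op Vp] nX]; apply/eqP; rewrite eq_le [_ <= x]Op leNgt; apply/negP => px.
  by apply: (nX (dist p B)); [rewrite px dist_ge0|split => //; rewrite /Onbhd/=].
- rewrite X0// XM -h0 -h1 -target0 -target1 !target_mono//.
by exists r.
Qed.

Let R1 t := step1 qs N t V B.

(** Trades the arbitrary [get] of the first branch for a parameter of the same measure with null
    level set, so that D g is Jordan measurable. In the second branch [B] is nonempty, because an
    empty [B] satisfies the zero-measure condition. *)
Let step1_cases t :
  (exists2 g, [/\ - N <= g <= N, good g & h g = clamp (target t)] &
     (good 2^-1 \/ ~ (0 <= t <= 1)) /\ R1 t = ci (D g)) \/
  (exists2 r, [/\ ~ good 2^-1, 0 <= t <= 1, B !=set0, 0 <= r & mu (X r) = target t] &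
     R1 t = ci (X r)).
Proof.
rewrite /R1 /step1 -/(target t).
case: ifPn => /asboolP c.
  left.
  have c' : good 2^-1 \/ ~ (0 <= t <= 1) by rewrite -zero_condE.
  have [g0 [g0N gg0] hg0] := davg_attained c'.
  have [|g1 mg1 uniq] := @minimizer_get (target t); first by exists g0.
  exists g0 => //; split => //.
  set P := (X in get X).
  have Pg : min_prop (target t) (get P).
    by apply: (@getPex _ P); exists g1.
  apply/seteqP; split; apply: ci_D_le; rewrite -/(h _) (uniq _ Pg) hg0//.
right.
have ng : ~ good 2^-1 by move=> g2; apply: c; left; apply/zero_condE.
have t01 : 0 <= t <= 1 by apply: contrapT => nt; apply: c; right.
have B0 : B !=set0.
  apply: contrapT => nB0; apply/ng/good_set0; apply/seteqP; split => // p Bp.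
  by apply: nB0; exists p.
set P := (X in get X).
have [r0 rE] : P (get P) by apply: (@getPex _ P); exact: Onbhd_attained.
by exists (get P).
Qed.

Let R1_Jn t : Jn (R1 t).
Proof.
have [[g [gN gg hg] [_ ->]]|[r [_ _ B0 r0 _] ->]] := step1_cases t.
  exact/Jn_ci/D_jordan.
exact/Jn_ci/X_jordan.
Qed.

Let mu_R1 t : mu (R1 t) = clamp (target t).
Proof.
have [[g [gN gg hg] [_ ->]]|[r [_ t01 B0 r0 hr] ->]] := step1_cases t.
  by rewrite mu_ci//; exact: D_jordan.
by rewrite mu_ci ?hr ?clamp_id//; exact: X_jordan.
Qed.

Let R1_0 : R1 0 = B.
Proof.
have [[g [gN gg hg] [_ ->]]|[r [_ t01 B0 r0 hr] ->]] := step1_cases 0.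
  rewrite clamp_id ?lexx ?ler01// target0 in hg.
  by rewrite -[RHS]ciD0; apply/seteqP; split; apply: ci_D_le; rewrite hg.
rewrite [RHS](Jn_eq JB); apply/esym; apply: ci_eq_jordan; last 1 first.
- apply: null_mu; first exact/boundedD/boundedIr.
  rewrite mu_setD; [|exact: boundedIr|exact: Jn_cmeas|].
    by rewrite hr target0 h0 subrr.
  by rewrite -{1}(X0 B0); exact: X_mono.
- by rewrite -{1}(X0 B0); exact: X_mono.
- exact: Jn_jordan.
Qed.

Let R1_1 : R1 1 = ci V.
Proof.
have [[g [gN gg hg] [_ ->]]|[r [_ t01 B0 r0 hr] ->]] := step1_cases 1.
  rewrite clamp_id ?lexx ?ler01// target1 in hg.
  by rewrite -ciD1; apply/seteqP; split; apply: ci_D_le; rewrite hg.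
have XV : X r `<=` V by move=> p [].
apply: ci_eq_jordan => //; first exact: X_jordan.
apply: null_mu; first exact: boundedD.
rewrite mu_setD//; last exact/jordan_cmeas/X_jordan.
by rewrite hr target1 h1 subrr.
Qed.

(** Where the two constructions alternate, the sets for s < 0 lie in [B], those for t > 1 contain
    [ci V], and the neighbourhood averages lie between these two. *)
Let R1_mono s t : s <= t -> R1 s `<=` R1 t.
Proof.
move=> st.
have ctt := clamp_mono (target_mono st).
have [[g [gN gg hg] [cs ->]]|[r [ng /andP[s0 s1] B0 r0 hr] ->]] := step1_cases s;
  have [[g' [gN' gg' hg'] [ct ->]]|[r' [ng' /andP[t0 t1] B0' r0' hr'] ->]] := step1_cases t.
- by apply: ci_D_le; rewrite hg hg'.
- have sn : s < 0.
    case: cs => [//|ns]; rewrite ltNge; apply/negP => s0; apply: ns.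
    by rewrite s0 (le_trans st).
  apply: (@subset_trans _ B).
    rewrite -ciD0; apply: ci_D_le; rewrite hg -target0 -[leRHS]clamp_id ?lexx ?ler01//.
    exact/clamp_mono/target_mono/ltW.
  rewrite {1}(Jn_eq JB); apply: le_ci; rewrite -{1}(X0 B0'); exact: X_mono.
- have tn : 1 < t.
    case: ct => [//|ns]; rewrite ltNge; apply/negP => t1; apply: ns.
    by rewrite t1 (le_trans s0).
  apply: (@subset_trans _ (ci V)); first by apply: le_ci => p [].
  rewrite -ciD1; apply: ci_D_le; rewrite hg' -target1 -[leLHS]clamp_id ?lexx ?ler01//.
  exact/clamp_mono/target_mono/ltW.
- have [rr'|rr'] := leP r r'; first by apply: le_ci; exact: X_mono.
  have XX : X r' `<=` X r by apply: X_mono; exact: ltW.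
  rewrite (_ : ci (X r) = ci (X r'))//; apply/esym; apply: ci_eq_jordan => //.
    exact: X_jordan.
  apply: null_mu; first exact/boundedD/boundedIr.
  rewrite mu_setD//; [|exact: boundedIr|exact/jordan_cmeas/X_jordan].
  apply/eqP; rewrite subr_eq0 eq_le; apply/andP; split.
    by rewrite hr hr' target_mono.
  by apply: le_mu => //; exact: boundedIr.
Qed.

Let clamp_lip u v : u <= v -> clamp v - clamp u <= v - u.
Proof.
move=> uv; have NN : h (- N) <= h N by exact/h_mono/NleN.
rewrite /clamp.
have [?|?] := leP u (h (- N)); have [?|?] := leP v (h (- N));
  rewrite ?(min_l NN); try (have [?|?] := leP u (h N)); try (have [?|?] := leP v (h N)); lra.
Qed.

(** For nested measurable sets [dmu] is the difference of the measures, and clamping does not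
    increase differences of the affine target. *)
Lemma step1_spec :
  [/\ forall t, Jn (step1 qs N t V B),
      forall s t, s <= t -> step1 qs N s V B `<=` step1 qs N t V B,
      step1 qs N 0 V B = B, step1 qs N 1 V B = ci V &
      forall s t, dmu (step1 qs N s V B) (step1 qs N t V B) <= `|t - s| * mu (V `\` B)].
Proof.
split => //; rewrite mu_setD//; last exact: Jn_cmeas.
move=> s t; wlog st : s t / s <= t.
  move=> W; have [st|/ltW ts] := leP s t; first exact: W.
  by rewrite dmuC distrC; exact: W.
rewrite dmu_sub; last exact: R1_mono.
rewrite mu_setD; [|exact/Jn_bounded/R1_Jn|exact/Jn_cmeas/R1_Jn|exact: R1_mono].
rewrite !mu_R1 ger0_norm ?subr_ge0//.
rewrite (le_trans (clamp_lip (target_mono st)))// /target.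
by rewrite le_eqVlt; apply/orP; left; apply/eqP; ring.
Qed.

End step_one.

(** * Nested sets *)

Section saturated_sets.
Variables (R : realType) (n : nat).
Local Notation E := 'rV[R]_n.+1.
Implicit Types (p q e : E) (S W : set E).

Lemma connected_segment p q : connected [set p + t *: (q - p) | t in `[0, 1]].
Proof.
apply: connected_continuous_connected; first exact: segment_connected.
apply: continuous_subspaceT => t.
by apply: cvgD; [exact: cvg_cst|apply: cvgZr_tmp; exact: cvg_id].
Qed.

(** The segment from the centre to any point of the ball stays in the ball, so components never
    split a ball. *)
Lemma eball_component S p (r : R) x : (forall z, enorm (z - p) < r -> S z) ->
  enorm (x - p) < r -> connected_component S p x.
Proof.
move=> rS xr.
have px : [set p + t *: (x - p) | t in `[0, 1]] x.
  by exists 1; rewrite ?scale1r ?subrKC//= in_itv/= lexx ler01.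
apply: (connected_component_max _ _ (@connected_segment p x) px).
  by exists 0; rewrite ?scale0r ?addr0//= in_itv/= lexx ler01.
move=> y [t /=]; rewrite in_itv/= => /andP[t0 t1] <-; apply: rS.
rewrite enormB segment_enorm0 ger0_norm// (le_lt_trans _ xr)//.
by rewrite ler_piMl// enorm_ge0.
Qed.

(** Unions of components of S: one notion for a single component and for the merged set of small
    ones. *)
Definition saturated S W :=
  W `<=` S /\ forall x, W x -> connected_component S x `<=` W.

Lemma saturated_ball S W p q (r : R) : saturated S W ->
  (forall z, enorm (z - p) < r -> S z) -> enorm (q - p) < r -> W q ->
  forall z, enorm (z - p) < r -> W z.
Proof.
move=> [_ sW] rS qp Wq z zp; apply: (sW q Wq).
apply: connected_component_trans (eball_component rS zp).
exact/connected_component_sym/(eball_component rS).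
Qed.

Lemma saturated_component S x : S x -> saturated S (connected_component S x).
Proof.
move=> Sx; split; first exact: connected_component_sub.
by move=> y xy z yz; exact: connected_component_trans yz.
Qed.

Lemma saturated_bigcup S (G : set (set E)) :
  (forall C, G C -> saturated S C) -> saturated S (\bigcup_(C in G) C).
Proof.
move=> sG; split; first by move=> x [C GC Cx]; exact: (sG _ GC).1.
by move=> x [C GC Cx] y xy; exists C => //; exact: (sG _ GC).2 xy.
Qed.

Lemma component_meet S C C' : components S C -> components S C' ->
  C `&` C' !=set0 -> C = C'.
Proof.
move=> [x _ <-] [y _ <-] [z [xz yz]].
by rewrite (same_connected_component xz) (same_connected_component yz).
Qed.

End saturated_sets.

Section nested_pair.
Variables (R : realType) (n : nat).
Local Notation E := 'rV[R]_n.+1.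
Implicit Types (p q e : E) (C W : set E).
Variables (A B : set E).
Hypotheses (JA : Jn A) (JB : Jn B) (BA : B `<=` A).
Local Notation S := (A `\` B).

Let inner_ball p : interior A p -> ~ B p ->
  exists2 r, 0 < r & forall z, enorm (z - p) < r -> S z.
Proof.
move=> iA nB.
have : nbhs p (interior A `&` ~` B).
  apply: open_nbhs_nbhs; split; last by split.
  apply: openI; first exact: open_interior.
  by apply: closed_openC; exact: Jn_closed.
by move=> /nbhs_enormP[r r0 h]; exists r => // z /h[/interior_subset].
Qed.

Lemma saturated_interior W p : saturated S W -> W p -> interior A p -> interior W p.
Proof.
move=> sW Wp iA; have [_ nB] := sW.1 _ Wp; have [r r0 rS] := inner_ball iA nB.
have pp : enorm (p - p) < r by rewrite subrr enorm0.
by apply/nbhs_enormP; exists r => //; exact: (saturated_ball sW rS pp Wp).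
Qed.

Lemma saturated_sub W : saturated S W -> B `|` W `<=` A.
Proof. by move=> sW p [/BA//|/sW.1[]]. Qed.

Let saturated_closure W p : saturated S W -> interior A p -> ~ B p ->
  closure (B `|` W) p -> W p.
Proof.
move=> sW iA nB /closure_enormP clp; have [r r0 rS] := inner_ball iA nB.
have [q [Bq|Wq] qp] := clp _ r0; first by have [] := rS q qp.
by apply: (saturated_ball sW rS qp Wq); rewrite subrr enorm0.
Qed.

(** A point in the interior of A and outside B has a ball that lies in W or misses it, so it is not
    a boundary point; what remains is in the boundary of A or of B. *)
Lemma saturated_jordan W : saturated S W -> jordan (B `|` W).
Proof.
move=> sW.
have bV : bounded_set (B `|` W) by apply: bounded_subset (Jn_bounded JA); exact: saturated_sub.
apply: (jordan_sub bV (Jn_jordan JA) (Jn_jordan JB)) => p [clp nint].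
have Ap : closure A p by apply: closure_subset clp; exact: saturated_sub.
have [iA|niA] := pselect (interior A p); last by left.
have [Bp|nB] := pselect (B p); last first.
  have Wp := saturated_closure sW iA nB clp.
  by exfalso; apply: nint; apply: filterS (saturated_interior sW Wp iA) => z; right.
right; split; first exact: subset_closure.
by move=> iB; apply: nint; apply: filterS iB => z; left.
Qed.

(** Supplies the hypothesis [clV] of Step 1, by which the average at t = 1 is [ci V] although D 1 is
    the closure of [V]. *)
Lemma saturated_interior_closure W : saturated S W ->
  interior (closure (B `|` W)) `<=` interior (B `|` W).
Proof.
move=> sW; rewrite -open_subsetE; last exact: open_interior.
move=> p ip; have [Bp|nB] := pselect (B p); [by left|right].
apply: saturated_closure => //; last exact: interior_subset.
have cA : closure A = A by rewrite -((closure_id A).1 (Jn_closed JA)).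
by apply: filterS ip => z clz; rewrite -cA; apply: closure_subset clz; exact: saturated_sub.
Qed.

Lemma saturated_setD W : saturated S W -> (B `|` W) `\` B = W.
Proof.
move=> sW; apply/seteqP; split => [p [[//|//]]|p Wp].
by split; [right|exact: (sW.1 _ Wp).2].
Qed.

Lemma saturated_jordan_self W : saturated S W -> jordan W.
Proof.
move=> sW; rewrite -(saturated_setD sW); apply: jordanD; last exact: Jn_jordan.
exact: saturated_jordan.
Qed.

End nested_pair.

(** * Finite unions and intersections under [dmu] *)

Section finite_families.
Variables (R : realType) (n : nat).
Local Notation E := 'rV[R]_n.+1.
Implicit Types (s : seq (set E)) (P Q : set E -> set E) (B C Y : set E).

Lemma sum_mu_disjoint s Y : uniq s -> bounded_set Y ->
  (forall C, C \in s -> jordan C /\ C `<=` Y) ->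
  (forall C C', C \in s -> C' \in s -> C `&` C' !=set0 -> C = C') ->
  \sum_(C <- s) mu C <= mu Y.
Proof.
elim: s Y => [|C s IH] Y; first by rewrite big_nil mu_ge0.
move=> /= /andP[Cs us] bY sY dis; rewrite big_cons.
have [jC CY] := sY C (mem_head _ _).
rewrite (mu_split bY (jordan_cmeas jC)) lerD//.
  apply: le_mu; last exact: boundedIl.
  by move=> p Cp; split => //; exact: CY.
apply: IH => //; first exact: boundedD.
- move=> C' C's; have [jC' C'Y] := sY C' (mem_behead (s := C :: s) C's).
  split => // p C'p; split; first exact: C'Y.
  move=> Cp; move: Cs; rewrite (dis C C') ?mem_head ?inE ?C's ?orbT//.
  by exists p.
- by move=> C1 C2 h1 h2; apply: dis; rewrite inE ?h1 ?h2 orbT.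
Qed.

Definition cupseq s P : set E := [set p | exists2 C, C \in s & P C p].

(** The factor [B] keeps the empty intersection bounded. For a nonempty family of averages with t <=
    0 it changes nothing, as each of them lies in [B]. *)
Definition capseq B s P : set E := [set p | B p /\ forall C, C \in s -> P C p].

Lemma cupseq_nil P : cupseq [::] P = set0.
Proof. by apply/seteqP; split => // p []. Qed.

Lemma cupseq_cons C s P : cupseq (C :: s) P = P C `|` cupseq s P.
Proof.
apply/seteqP; split => p /=.
  by move=> [C']; rewrite inE => /orP[/eqP ->|C's]; [left|right; exists C'].
move=> [PC|[C' C's PC']]; first by exists C; rewrite ?mem_head.
by exists C' => //; rewrite inE C's orbT.
Qed.

Lemma capseq_nil B P : capseq B [::] P = B.
Proof. by apply/seteqP; split => p //= []. Qed.

Lemma capseq_cons B C s P : capseq B (C :: s) P = P C `&` capseq B s P.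
Proof.
apply/seteqP; split => p /=.
  move=> [Bp h]; split; first by apply: h; rewrite mem_head.
  by split => // C' C's; apply: h; rewrite inE C's orbT.
by move=> [PC [Bp h]]; split => // C'; rewrite inE => /orP[/eqP ->|/h].
Qed.

Lemma Jn_cupseq s P : (forall C, C \in s -> Jn (P C)) -> Jn (cupseq s P).
Proof.
elim: s => [_|C s IH h]; first by rewrite cupseq_nil; exact: Jn0.
rewrite cupseq_cons; apply: JnU; first by apply: h; rewrite mem_head.
by apply: IH => C' C's; apply: h; rewrite inE C's orbT.
Qed.

Lemma jordan_capseq B s P : jordan B -> (forall C, C \in s -> jordan (P C)) ->
  jordan (capseq B s P).
Proof.
move=> jB; elim: s => [_|C s IH h]; first by rewrite capseq_nil.
rewrite capseq_cons; apply: jordanI; first by apply: h; rewrite mem_head.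
by apply: IH => C' C's; apply: h; rewrite inE C's orbT.
Qed.

Lemma bounded_cupseq s P : (forall C, C \in s -> bounded_set (P C)) ->
  bounded_set (cupseq s P).
Proof.
elim: s => [_|C s IH h]; first by rewrite cupseq_nil; exists 0.
rewrite cupseq_cons; apply: boundedU; first by apply: h; rewrite mem_head.
by apply: IH => C' C's; apply: h; rewrite inE C's orbT.
Qed.

Lemma bounded_capseq B s P : bounded_set B -> bounded_set (capseq B s P).
Proof. by apply: bounded_subset => p []. Qed.

Lemma dmu_cupseq s P Q : (forall C, C \in s -> bounded_set (P C)) ->
  (forall C, C \in s -> bounded_set (Q C)) ->
  dmu (cupseq s P) (cupseq s Q) <= \sum_(C <- s) dmu (P C) (Q C).
Proof.
elim: s => [|C s IH] bP bQ; first by rewrite !cupseq_nil dmu_xx big_nil.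
have bP' C' : C' \in s -> bounded_set (P C') by move=> h; apply: bP; rewrite inE h orbT.
have bQ' C' : C' \in s -> bounded_set (Q C') by move=> h; apply: bQ; rewrite inE h orbT.
rewrite !cupseq_cons big_cons; apply: le_trans (dmuU _ _ _ _) _.
- by apply: bP; rewrite mem_head.
- exact: bounded_cupseq.
- by apply: bQ; rewrite mem_head.
- exact: bounded_cupseq.
- by rewrite lerD2l IH.
Qed.

Lemma dmu_capseq B s P Q : bounded_set B ->
  (forall C, C \in s -> bounded_set (P C)) ->
  (forall C, C \in s -> bounded_set (Q C)) ->
  dmu (capseq B s P) (capseq B s Q) <= \sum_(C <- s) dmu (P C) (Q C).
Proof.
move=> bB; elim: s => [|C s IH] bP bQ; first by rewrite !capseq_nil dmu_xx big_nil.
have bP' C' : C' \in s -> bounded_set (P C') by move=> h; apply: bP; rewrite inE h orbT.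
have bQ' C' : C' \in s -> bounded_set (Q C') by move=> h; apply: bQ; rewrite inE h orbT.
rewrite !capseq_cons big_cons; apply: le_trans (dmuI _ _ _ _) _.
- by apply: bP; rewrite mem_head.
- exact: bounded_capseq.
- by apply: bQ; rewrite mem_head.
- exact: bounded_capseq.
- by rewrite lerD2l IH.
Qed.

(** The triangle inequality through [T c]. The predicate [D] permits gluing on a half-line before
    gluing on the whole line. *)
Lemma dmu_glue (T : R -> set E) (D : R -> Prop) (c K : R) :
  (forall t, bounded_set (T t)) -> D c ->
  (forall s t : R, D s -> D t -> s <= c -> t <= c -> dmu (T s) (T t) <= `|t - s| * K) ->
  (forall s t : R, D s -> D t -> c <= s -> c <= t -> dmu (T s) (T t) <= `|t - s| * K) ->
  forall s t : R, D s -> D t -> dmu (T s) (T t) <= `|t - s| * K.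
Proof.
move=> bT Dc lo hi s t; wlog st : s t / s <= t.
  move=> W Ds Dt; have [st|/ltW ts] := leP s t; first exact: W.
  by rewrite dmuC distrC; exact: W.
move=> Ds Dt.
have [tc|/ltW ct] := leP t c; first by apply: lo => //; exact: le_trans tc.
have [sc|/ltW cs] := leP s c; last exact: hi.
apply: le_trans (dmu_triangle (bT s) (bT c) (bT t)) _.
apply: le_trans (lerD (lo s c Ds Dc sc (lexx _)) (hi c t Dc Dt (lexx _) ct)) _.
by rewrite !ger0_norm ?subr_ge0// -mulrDl addrC addrA subrK.
Qed.

End finite_families.

(** * The Step 2 averages *)

Section step_two.
Variables (R : realType) (n : nat).
Local Notation E := 'rV[R]_n.+1.
Implicit Types (p q e : E) (C W : set E).
Variables (A B : set E) (eps : R).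
Hypotheses (JA : Jn A) (JB : Jn B) (BA : B `<=` A) (eps0 : 0 < eps).
Local Notation S := (A `\` B).
Local Notation F := (step2_family eps A B).

Let components_saturated C : components S C -> saturated S C.
Proof. by move=> [x Sx <-]; exact: saturated_component. Qed.

Let components_nonempty C : components S C -> C !=set0.
Proof. by move=> [x Sx <-]; exists x; exact: connected_component_refl. Qed.

(** Components are disjoint and contained in A, so at most mu(A) / eps of them have measure at least
    eps. *)
Let big_finite : finite_set [set C | components S C /\ eps <= mu C].
Proof.
apply: contrapT => inf.
pose m := (Num.truncn (mu A / eps)).+1.
have [X Xsub Xm] := infinite_set_fset m inf.
have hX C : C \in finmap.enum_fset X -> components S C /\ eps <= mu C.
  by move=> CX; exact: Xsub.
have le1 : \sum_(C <- finmap.enum_fset X) mu C <= mu A.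
  apply: sum_mu_disjoint; [exact: finmap.fset_uniq|exact: Jn_bounded| |].
    move=> C /hX[/components_saturated sC _]; split.
      exact: (saturated_jordan_self JA JB BA sC).
    by move=> p /sC.1[].
  by move=> C C' /hX[cC _] /hX[cC' _]; exact: (component_meet cC cC').
have le2 : m%:R * eps <= \sum_(C <- finmap.enum_fset X) mu C.
  apply: (@le_trans _ _ (\sum_(C <- finmap.enum_fset X) eps)).
    rewrite big_const_seq count_predT iter_addr_0 -[leRHS]mulr_natl.
    by rewrite ler_wpM2r ?ler_nat// ltW.
  by rewrite big_seq [leRHS]big_seq; apply: ler_sum => C /hX[].
have /truncn_itv/andP[_] : 0 <= mu A / eps by rewrite divr_ge0 ?mu_ge0// ltW.
rewrite ltr_pdivrMr// -/m => lt.
by have := le_trans le2 le1; rewrite leNgt lt.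
Qed.

Let U : set E := \bigcup_(C in [set C | components S C /\ mu C < eps]) C.

Let U_saturated : saturated S U.
Proof. by apply: saturated_bigcup => C [/components_saturated]. Qed.

Lemma step2_family_saturated C : F C -> saturated S C.
Proof.
rewrite /step2_family; case: ifPn => _; first exact: components_saturated.
by move=> [[/components_saturated]|->].
Qed.

Lemma step2_family_finite : finite_set F.
Proof.
rewrite /step2_family; case: ifPn => [/asboolP//|_].
by rewrite finite_setU; split => //; exact: finite_set1.
Qed.

(** The case to check is the merged set: among infinitely many components only finitely many are
    large, so a small one exists. *)
Lemma step2_family_nonempty C : F C -> C !=set0.
Proof.
rewrite /step2_family; case: ifPn => [_|/asboolP inf]; first exact: components_nonempty.
move=> [[/components_nonempty]//|->].
have [C0 [cC0 C0e]] : exists C0, components S C0 /\ mu C0 < eps.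
  apply: contrapT => no; apply: inf; apply: sub_finite_set big_finite => C1 cC1.
  by split => //; rewrite leNgt; apply/negP => lt; apply: no; exists C1.
by have [x C0x] := components_nonempty cC0; exists x, C0.
Qed.

Lemma step2_family_meet C C' : F C -> F C' -> C `&` C' !=set0 -> C = C'.
Proof.
rewrite /step2_family; case: ifPn => _; first by move=> cC cC'; exact: (component_meet cC cC').
have UC C1 C2 : components S C1 -> eps <= mu C1 -> components S C2 -> mu C2 < eps ->
    C1 `&` C2 !=set0 -> False.
  move=> c1 m1 c2 m2 /(component_meet c1 c2) e; move: m2; rewrite -e.
  by rewrite ltNge m1.
move=> [[cC mC]|->] [[cC' mC']|->] // meet.
- exact: (component_meet cC cC').
- have [z [Cz [C2 [c2 m2] C2z]]] := meet; exfalso.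
  by apply: UC cC mC c2 m2 _; exists z.
- have [z [[C2 [c2 m2] C2z] Cz]] := meet; exfalso.
  by apply: UC cC' mC' c2 m2 _; exists z.
Qed.

Lemma step2_family_cover p : S p -> exists2 C, F C & C p.
Proof.
move=> Sp; have cp : components S (connected_component S p) by exists p.
have pp := connected_component_refl Sp.
rewrite /step2_family; case: ifPn => _; first by exists (connected_component S p).
have [big|small] := leP eps (mu (connected_component S p)).
  by exists (connected_component S p) => //; left.
by exists U; [right|exists (connected_component S p)].
Qed.

Variables (qs : set E -> E) (N : R).
Hypotheses (N1 : 1 <= N) (qsP : centre_selector qs).
Local Notation T := (fun t => step2 qs N eps t A B).

Let RC t C := step1 qs N t (B `|` C) B.

Let RC_spec C : F C ->
  [/\ forall t, Jn (RC t C), forall s t, s <= t -> RC s C `<=` RC t C,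
      RC 0 C = B, RC 1 C = ci (B `|` C) &
      forall s t, dmu (RC s C) (RC t C) <= `|t - s| * mu C].
Proof.
move=> FC; have sC := step2_family_saturated FC.
rewrite -[X in mu X](saturated_setD sC); apply: (step1_spec N1 qsP JB _ (saturated_jordan JA JB BA sC) _
  (saturated_interior_closure JA JB BA sC)); first by move=> p; left.
by have [x Cx] := step2_family_nonempty FC; exists x; right.
Qed.

Lemma step2_spec :
  [/\ forall t, Jn (T t), T 0 = B /\ T 1 = A,
      forall t, 0 <= t -> B `<=` T t, forall t, t <= 0 -> T t `<=` B &
      (forall t, t <= 1 -> T t `<=` A) /\
      forall s t, dmu (T s) (T t) <= `|t - s| * mu (A `\` B)].
Proof.
have [AB|AB] := pselect (A = B).
  have TE t : step2 qs N eps t A B = A by rewrite /step2 asboolT.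
  split; rewrite ?TE//.
  - by move=> t; rewrite TE.
  - by move=> t _; rewrite TE.
  - by move=> t _; rewrite TE AB.
  - split=> [t _|s t]; rewrite !TE//.
    by rewrite dmu_xx mulr_ge0 ?mu_ge0.
have [s0 Fs0] := (finite_seqP _).1 step2_family_finite.
(* Without repetitions the measures of the disjoint members sum to at most mu(A \ B). *)
pose s := undup s0.
have sF C : (C \in s) = (C \in s0) by rewrite mem_undup.
have FsE C : F C <-> C \in s by rewrite sF Fs0.
have us : uniq s := undup_uniq s0.
have [C0 FC0] : exists C0, F C0.
  have [p Sp] : S !=set0.
    apply: contrapT => nS; apply: AB; apply/seteqP; split => // p Ap.
    by apply: contrapT => nB; apply: nS; exists p.
  by have [C FC _] := step2_family_cover Sp; exists C.
have TE t : T t = if 0 <= t then cupseq s (RC t) else ci (capseq B s (RC t)).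
  rewrite /step2 asboolF//; case: ifPn => t0.
    by apply/seteqP; split => p [C /FsE sC Cp]; exists C => //; exact/FsE.
  congr ci; apply/seteqP; split => p /= h.
    split; last by move=> C /FsE; exact: h.
    have [_ mono R0 _ _] := RC_spec FC0; rewrite -R0.
    by apply: mono (h _ FC0); rewrite ltW// ltNge.
  by move=> C /FsE; exact: h.2.
have JRC t C : C \in s -> Jn (RC t C) by move=> /FsE /RC_spec[].
have JT t : Jn (T t).
  rewrite TE; case: ifPn => _; first by apply: Jn_cupseq => C; exact: JRC.
  apply: Jn_ci; apply: jordan_capseq; first exact: Jn_jordan.
  by move=> C /JRC h; exact: Jn_jordan.
have T0 : T 0 = B.
  rewrite TE lexx; apply/seteqP; split => p.
    by move=> [C /FsE /RC_spec[_ _ -> _ _]].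
  by move=> Bp; exists C0; [exact/FsE|have [_ _ -> _ _] := RC_spec FC0].
have BT t : 0 <= t -> B `<=` T t.
  move=> t0 p Bp; rewrite TE t0; exists C0; first exact/FsE.
  by have [_ mono R0 _ _] := RC_spec FC0; apply: (mono 0) => //; rewrite R0.
have TB t : t <= 0 -> T t `<=` B.
  rewrite le_eqVlt => /orP[/eqP ->|t0]; first by rewrite T0.
  rewrite TE leNgt t0 /=; apply: (@subset_trans _ (ci B)).
    by apply: le_ci => p [].
  by rewrite -(Jn_eq JB).
have RA C : F C -> RC 1 C `<=` A.
  move=> FC; have [_ _ _ -> _] := RC_spec FC; rewrite (Jn_eq JA).
  by apply: le_ci; exact: (saturated_sub BA (step2_family_saturated FC)).
have TA t : t <= 1 -> T t `<=` A.
  move=> t1; have [t0|t0] := leP 0 t; last first.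
    by apply: subset_trans BA; apply: TB; exact: ltW.
  rewrite TE t0 => p [C /FsE FC]; have [_ mono _ _ _] := RC_spec FC.
  by move=> /(mono _ _ t1); exact: RA.
(* T 1 is closed, so it suffices to catch the interior of A: such a point outside B is interior to
   the member C that contains it, hence in the [ci] of the union of B and C. *)
have T1 : T 1 = A.
  apply/seteqP; split; first exact: TA.
  suff iA : interior A `<=` T 1.
    by rewrite {1}(Jn_eq JA) [T 1 in X in _ `<=` X](closure_id _).1; [exact: closure_subset|exact: Jn_closed].
  move=> p iA; have [Bp|nB] := pselect (B p); first exact: BT.
  have Ap := interior_subset iA.
  have [C FC Cp] := @step2_family_cover p (conj Ap nB).
  rewrite TE ler01; exists C; first exact/FsE.
  have [_ _ _ -> _] := RC_spec FC; apply: interior_sub_ci.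
  have iC := saturated_interior JB (step2_family_saturated FC) Cp iA.
  by apply: filterS iC => z; right.
have summu : \sum_(C <- s) mu C <= mu S.
  apply: sum_mu_disjoint => //; first exact: boundedD (Jn_bounded JA).
    move=> C /FsE FC; have sC := step2_family_saturated FC; split; last exact: sC.1.
    exact: (saturated_jordan_self JA JB BA sC).
  by move=> C C' /FsE FC /FsE FC'; exact: step2_family_meet.
have sumd x t : \sum_(C <- s) dmu (RC x C) (RC t C) <= `|t - x| * mu S.
  apply: (@le_trans _ _ (`|t - x| * \sum_(C <- s) mu C)); last by rewrite ler_wpM2l.
  rewrite mulr_sumr big_seq [leRHS]big_seq; apply: ler_sum => C /FsE FC.
  by have [_ _ _ _] := RC_spec FC.
have bT t := Jn_bounded (JT t).
have bRC t C (sC : C \in s) : bounded_set (RC t C) by exact/Jn_bounded/JRC.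
split => //; split => //.
move=> x t; apply: (@dmu_glue _ _ (fun t => step2 qs N eps t A B) (fun=> True) 0) => // {}x {}t _ _ x0 t0; last first.
  by rewrite !TE x0 t0; apply: le_trans (sumd x t); apply: dmu_cupseq; exact: bRC.
(* The intersection before [ci], at distance 0 from [T t] for t <= 0; the estimate for finite
   intersections applies to it. *)
pose T' t := capseq B s (RC t).
have jT' y : jordan (T' y).
  apply: jordan_capseq; first exact: Jn_jordan.
  by move=> C sC; exact/Jn_jordan/JRC.
have TT' y : y <= 0 -> dmu (T y) (T' y) = 0.
  rewrite le_eqVlt => /orP[/eqP ->|y0]; last first.
    by rewrite TE leNgt y0 /= dmuC dmu_ci.
  rewrite T0 (_ : T' 0 = B) ?dmu_xx//; apply/seteqP; split => p; first by case.
  by move=> Bp; split => // C /FsE /RC_spec[_ _ -> _ _].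
have bT' y : bounded_set (T' y) := (jT' y).1.
apply: le_trans (dmu_triangle (bT x) (bT' x) (bT t)) _; rewrite TT'// add0r.
apply: le_trans (dmu_triangle (bT' x) (bT' t) (bT t)) _.
rewrite [X in _ + X]dmuC TT'// addr0.
by apply: le_trans (sumd x t); apply: dmu_capseq; [exact: Jn_bounded|exact: bRC|exact: bRC].
Qed.

End step_two.

(** * General pairs *)

Section measure_average.
Variables (R : realType) (n : nat).
Local Notation E := 'rV[R]_n.+1.
Local Notation leb := (@leb_outer R n.+1).
Implicit Types (A B : set E).
Variables (N eps : R) (qs : set E -> E).
Hypotheses (N1 : 1 <= N) (eps0 : 0 < eps) (qsP : centre_selector qs).

(** The Lipschitz estimate from 0 gives an upper bound, the one from 1 a lower bound, and the two
    coincide. *)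
Lemma mu_step2 A B t : Jn A -> Jn B -> B `<=` A -> 0 <= t <= 1 ->
  mu (step2 qs N eps t A B) = t * mu A + (1 - t) * mu B.
Proof.
move=> JA JB BA /andP[t0 t1].
have [JT [T0 T1] _ _ [_ dT]] := step2_spec JA JB BA eps0 N1 qsP.
have bT u := Jn_bounded (JT u).
have h0 := le_trans (mu_dmu (bT 0) (bT t)) (dT 0 t).
have h1 := le_trans (mu_dmu (bT t) (bT 1)) (dT t 1).
have n1 : `|1 - t| = 1 - t by rewrite ger0_norm// subr_ge0.
move: h0 h1; rewrite T0 T1 subr0 (ger0_norm t0) n1.
rewrite mu_setD//; [|exact: Jn_bounded|exact: Jn_cmeas].
rewrite !ler_norml => /andP[? ?] /andP[? ?].
by apply/eqP; rewrite eq_le; apply/andP; split; lra.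
Qed.

Let Rt u A B := step2 qs N eps u A (ci (A `&` B)).

Let jordan_cap A B : Jn A -> Jn B -> jordan (A `&` B).
Proof. by move=> JA JB; apply: jordanI; exact: Jn_jordan. Qed.

Let capE A B : Jn A -> Jn B -> ci (A `&` B) `<=` A `&` B.
Proof.
by move=> JA JB; apply: ci_sub_closed; apply: closedI; exact: Jn_closed.
Qed.

Let Rt_spec A B : Jn A -> Jn B ->
  [/\ forall t, Jn (Rt t A B), Rt 0 A B = ci (A `&` B) /\ Rt 1 A B = A,
      forall t, 0 <= t -> ci (A `&` B) `<=` Rt t A B,
      forall t, t <= 0 -> Rt t A B `<=` ci (A `&` B) &
      (forall t, t <= 1 -> Rt t A B `<=` A) /\
      forall s t, dmu (Rt s A B) (Rt t A B) <= `|t - s| * mu (A `\` ci (A `&` B))].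
Proof.
move=> JA JB; apply: step2_spec => //; first exact/Jn_ci/jordan_cap.
by move=> p /(capE JA JB)[].
Qed.

Let cap_null A B : Jn A -> Jn B -> leb ((A `&` B) `\` ci (A `&` B)) = 0%E.
Proof.
move=> JA JB; apply: leb_outer_null_sub (jordan_null (jordan_cap JA JB)).
move=> p [ABp nc]; split; first exact: subset_closure.
by move=> /interior_sub_ci.
Qed.

(** The sum of the Lipschitz constants that Step 2 gives for the two nested pairs of Step 3. *)
Let K A B := mu (A `\` ci (A `&` B)) + mu (B `\` ci (A `&` B)).

Let mu_diff_cap A B : Jn A -> Jn B -> mu (A `\` ci (A `&` B)) <= mu (A `\` B).
Proof.
move=> JA JB; have bA := Jn_bounded JA.
rewrite -[leRHS]addr0 -(mu_null (cap_null JA JB)).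
apply: le_trans (mu_setU_le _ _); [|exact: boundedD|exact/boundedD/boundedIl].
apply: le_mu; last by apply: boundedU; [exact: boundedD|exact/boundedD/boundedIl].
by move=> p [Ap nI]; have [Bp|nB] := pselect (B p); [right|left].
Qed.

(** A \ B and B \ A are disjoint, and replacing the intersection by its [ci] changes each difference
    by a null set only. *)
Let K_dmu A B : Jn A -> Jn B -> K A B <= dmu A B.
Proof.
move=> JA JB; have bA := Jn_bounded JA; have bB := Jn_bounded JB.
rewrite /dmu (mu_split (bounded_symdiff bA bB) (Jn_cmeas JB)) addrC /K.
apply: lerD.
  apply: le_trans (mu_diff_cap JA JB) _; apply: le_mu; last exact/boundedD/bounded_symdiff.
  by move=> p [Ap nB]; split => //; left.
rewrite setIC; apply: le_trans (mu_diff_cap JB JA) _.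
apply: le_mu; last exact/boundedIl/bounded_symdiff.
by move=> p [Bp nA]; split => //; right.
Qed.

Let M t A B := mavg qs N eps t A B.

Let M_mid t A B : A <> B -> 0 <= t <= 1 -> M t A B = Rt t A B `|` Rt (1 - t) B A.
Proof.
by move=> AB t01; rewrite /M /mavg asboolF// t01 /Rt (setIC B A).
Qed.

Let M_big t A B : A <> B -> 1 < t ->
  M t A B = ci (Rt t A B `\` (A `&` B)) `|` Rt (1 - t) B A.
Proof.
move=> AB t1; rewrite /M /mavg asboolF// [t <= 1]leNgt t1 andbF /=.
by rewrite /Rt (setIC B A).
Qed.

(** The branches of the definition correspond under this reflection, so negative t reduces to
    parameters above 1. *)
Let M_sym t A B : M t A B = M (1 - t) B A.
Proof.
have [->|AB] := pselect (A = B); first by rewrite /M /mavg !asboolT.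
have BA : B <> A by move=> h; apply: AB.
have [t1|t1] := leP t 1; last first.
  rewrite M_big// /M /mavg asboolF// subr_ge0 leNgt t1 /= ltrBrDr.
  rewrite (_ : 1 + t < 1 = false); last by apply/negP; lra.
  by rewrite subKr /Rt (setIC B A).
have [t0|t0] := leP 0 t.
  have t01' : 0 <= 1 - t <= 1 by apply/andP; split; lra.
  by rewrite !M_mid ?t0// subKr setUC.
rewrite [RHS]M_big//; last by lra.
rewrite /M /mavg asboolF// [0 <= t]leNgt t0 /= ltNge t1 /=.
by rewrite /Rt subKr (setIC B A).
Qed.

Let M_Jn t A B : Jn A -> Jn B -> Jn (M t A B).
Proof.
wlog t0 : t A B / 0 <= t.
  move=> W JA JB; have [t0|t0] := leP 0 t; first exact: W.
  by rewrite M_sym; apply: W => //; lra.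
move=> JA JB; have [AB|AB] := pselect (A = B); first by rewrite /M /mavg asboolT.
have [JR _ _ _ _] := Rt_spec JA JB; have [JR' _ _ _ _] := Rt_spec JB JA.
have [t1|t1] := leP t 1; first by rewrite M_mid ?t0//; exact: JnU.
rewrite M_big//; apply: JnU => //; apply: Jn_ci; apply: jordanD; last exact: jordan_cap.
exact: Jn_jordan.
Qed.

Let M1 A B : Jn A -> Jn B -> M 1 A B = A.
Proof.
move=> JA JB; have [AB|AB] := pselect (A = B); first by rewrite /M /mavg asboolT.
have [_ [_ R1] _ _ _] := Rt_spec JA JB; have [_ [R0 _] _ _ _] := Rt_spec JB JA.
rewrite M_mid ?lexx ?ler01// subrr R1 R0 setUidl//.
by move=> p /(capE JB JA)[].
Qed.

Let M0 A B : Jn A -> Jn B -> M 0 A B = B.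
Proof. by move=> JA JB; rewrite M_sym subr0 M1. Qed.

Let M_dmu_mid A B s t : A <> B -> Jn A -> Jn B -> 0 <= s <= 1 -> 0 <= t <= 1 ->
  dmu (M s A B) (M t A B) <= `|t - s| * K A B.
Proof.
move=> AB JA JB s01 t01; rewrite !M_mid//.
have [JR _ _ _ [_ dR]] := Rt_spec JA JB; have [JR' _ _ _ [_ dR']] := Rt_spec JB JA.
apply: le_trans (dmuU (Jn_bounded (JR s)) (Jn_bounded (JR' (1 - s)))
  (Jn_bounded (JR t)) (Jn_bounded (JR' (1 - t)))) _.
rewrite /K mulrDr; apply: lerD; first exact: dR.
apply: le_trans (dR' _ _) _; rewrite (setIC B A) opprB addrA.
by rewrite (_ : 1 - t + s - 1 = s - t) 1?distrC//; lra.
Qed.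

Let M_dmu_big A B s t : A <> B -> Jn A -> Jn B -> 1 <= s -> 1 <= t ->
  dmu (M s A B) (M t A B) <= `|t - s| * K A B.
Proof.
move=> AB JA JB s1 t1.
have [JR [_ R1] _ _ [_ dR]] := Rt_spec JA JB; have [JR' [R0 _] _ _ [_ dR']] := Rt_spec JB JA.
have jC := jordan_cap JA JB.
(* The formula before [ci]. At u = 1 it gives A up to the part of the intersection outside its [ci],
   a null set, so the estimate includes the end point 1, where [M] is defined by another branch. *)
pose M' u := (Rt u A B `\` (A `&` B)) `|` Rt (1 - u) B A.
have jD u : jordan (Rt u A B `\` (A `&` B)) by apply: jordanD => //; exact: Jn_jordan.
have bM' u : bounded_set (M' u).
  by apply: boundedU; [case: (jD u)|exact: Jn_bounded].
have bM u : bounded_set (M u A B) := Jn_bounded (M_Jn u JA JB).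
have MM' u : 1 <= u -> dmu (M u A B) (M' u) = 0.
  rewrite le_eqVlt => /orP[/eqP <-|u1].
    rewrite M1// /M' R1 subrr R0 dmuC dmu_sub.
      apply: mu_null; apply: leb_outer_null_sub (cap_null JA JB) => p [Ap h].
      have ABp : (A `&` B) p by apply: contrapT => nAB; apply: h; left.
      by split => // Ip; apply: h; right; rewrite setIC.
    by move=> p [[]//|/(capE JB JA)[]].
  apply/eqP; rewrite eq_le dmu_ge0 andbT M_big//.
  have [bD _] := jD u; have bY := Jn_bounded (JR' (1 - u)).
  apply: le_trans (dmuU (bounded_ci bD) bY bD bY) _.
  by rewrite dmu_xx addr0 dmuC dmu_ci.
apply: le_trans (dmu_triangle (bM s) (bM' s) (bM t)) _; rewrite MM'// add0r.
apply: le_trans (dmu_triangle (bM' s) (bM' t) (bM t)) _.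
rewrite [X in _ + X]dmuC MM'// addr0.
apply: le_trans (dmuU (jD s).1 (Jn_bounded (JR' _)) (jD t).1 (Jn_bounded (JR' _))) _.
rewrite /K mulrDr; apply: lerD.
  by apply: le_trans (dR _ _); apply: dmuD; exact: Jn_bounded.
apply: le_trans (dR' _ _) _; rewrite (setIC B A) opprB addrA.
by rewrite (_ : 1 - t + s - 1 = s - t) 1?distrC//; lra.
Qed.

Let K_sym A B : K A B = K B A.
Proof. by rewrite /K (setIC B A) addrC. Qed.

Let M_submetric A B s t : Jn A -> Jn B ->
  dmu (M s A B) (M t A B) <= `|t - s| * dmu A B.
Proof.
move=> JA JB; have [AB|AB] := pselect (A = B).
  by rewrite /M /mavg !asboolT// dmu_xx mulr_ge0 ?dmu_ge0.
apply: (@le_trans _ _ (`|t - s| * K A B)); last by rewrite ler_wpM2l// K_dmu.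
have bM u : bounded_set (M u A B) := Jn_bounded (M_Jn u JA JB).
(* Three regimes, glued at 1 and, on the half-line below 1, at 0; negative parameters are reflected
   to parameters above 1. *)
apply: (@dmu_glue _ _ (fun u => M u A B) (fun=> True) 1) => //; last first.
  by move=> x y _ _ *; exact: M_dmu_big.
move=> x y _ _; apply: (@dmu_glue _ _ (fun u => M u A B) (fun u => u <= 1) 0) => //.
  move=> {}x {}y _ _ x0 y0; rewrite !(M_sym _ A B) K_sym.
  have -> : `|y - x| = `|(1 - y) - (1 - x)|.
    by rewrite (distrC y x); congr (`|_|); ring.
  by apply: M_dmu_big => //; [exact: nesym|lra|lra].
by move=> {}x {}y x1 y1 x0 y0; apply: M_dmu_mid => //; rewrite ?x0 ?y0.
Qed.

Let M_metric A B s t : Jn A -> Jn B -> 0 <= s <= 1 -> 0 <= t <= 1 ->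
  dmu (M s A B) (M t A B) = `|t - s| * dmu A B.
Proof.
move=> JA JB; wlog st : s t / s <= t.
  move=> W s01 t01; have [st|/ltW ts] := leP s t; first exact: W.
  by rewrite dmuC distrC; exact: W.
move=> /andP[s0 s1] /andP[t0 t1]; apply/eqP; rewrite eq_le M_submetric//=.
have bM u : bounded_set (M u A B) := Jn_bounded (M_Jn u JA JB).
have h1 := dmu_triangle (bM 0) (bM s) (bM 1).
have h2 := dmu_triangle (bM s) (bM t) (bM 1).
have h3 := M_submetric 0 s JA JB; have h4 := M_submetric t 1 JA JB.
have n1 : `|1 - t| = 1 - t by rewrite ger0_norm// subr_ge0.
have n2 : `|t - s| = t - s by rewrite ger0_norm// subr_ge0.
move: h1 h2 h3 h4; rewrite !M0// !M1// (dmuC B A) subr0 (ger0_norm s0) n1 n2.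
have arith (d x y z w : R) : d <= y + w -> w <= x + z -> y <= s * d ->
    z <= (1 - t) * d -> (t - s) * d <= x by move=> *; lra.
exact: arith.
Qed.

Let M_bounds A B t : Jn A -> Jn B -> 0 <= t <= 1 ->
  ci (A `&` B) `<=` M t A B /\ M t A B `<=` A `|` B.
Proof.
move=> JA JB /andP[t0 t1]; have [AB|AB] := pselect (A = B).
  by rewrite /M /mavg asboolT// -AB setIid setUid -(Jn_eq JA); split.
have [_ _ lo _ [hi _]] := Rt_spec JA JB; have [_ _ _ _ [hi' _]] := Rt_spec JB JA.
rewrite M_mid// ?t0//; split; first by move=> p /(lo t t0) h; left.
by move=> p [/(hi t t1)|/hi' h]; [left|right; apply: h; lra].
Qed.

(** The overlap of the two Step 2 averages lies between the [ci] of the intersection of A and B and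
    the intersection itself, which differ by a null set. It is counted with weights 1 - t and t in
    the two averages, so subtracting it once cancels it. *)
Let M_mu A B t : Jn A -> Jn B -> 0 <= t <= 1 ->
  mu (M t A B) = t * mu A + (1 - t) * mu B.
Proof.
move=> JA JB t01; have [AB|AB] := pselect (A = B).
  by rewrite /M /mavg asboolT// -AB; ring.
have t01' : 0 <= 1 - t <= 1 by case/andP: t01 => ? ?; apply/andP; split; lra.
have /andP[t0 t1] := t01; have /andP[t0' t1'] := t01'.
have JI : Jn (ci (A `&` B)) by exact/Jn_ci/jordan_cap.
have IA : ci (A `&` B) `<=` A by move=> p /(capE JA JB)[].
have IB : ci (A `&` B) `<=` B by move=> p /(capE JA JB)[].
have [JR _ lo _ [hi _]] := Rt_spec JA JB.
have [JR' _ lo' _ [hi' _]] := Rt_spec JB JA.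
have m1 : mu (Rt t A B) = t * mu A + (1 - t) * mu (ci (A `&` B)) by exact: mu_step2.
have m2 : mu (Rt (1 - t) B A) = (1 - t) * mu B + (1 - (1 - t)) * mu (ci (A `&` B)).
  by rewrite /Rt (setIC B A); exact: mu_step2.
rewrite M_mid//; set X := Rt t A B in m1 *; set Y := Rt (1 - t) B A in m2 *.
have bX : bounded_set X := Jn_bounded (JR t).
have bY : bounded_set Y := Jn_bounded (JR' (1 - t)).
rewrite (mu_split (boundedU bX bY) (Jn_cmeas (JR t))) -/X.
rewrite (_ : (X `|` Y) `&` X = X); last by rewrite setIUl setIid setUidl//; move=> p [].
rewrite (_ : (X `|` Y) `\` X = Y `\` X); last by rewrite setDUl setDv set0U.
have YX : mu (Y `\` X) = mu (Y `\` ci (A `&` B)).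
  apply/eqP; rewrite eq_le; apply/andP; split.
    apply: le_mu; last exact: boundedD.
    by move=> p [Yp nX]; split => // /(lo t t0).
  rewrite -[leRHS]addr0 -(mu_null (cap_null JA JB)).
  have bC : bounded_set ((A `&` B) `\` ci (A `&` B)).
    exact/boundedD/boundedIl/Jn_bounded.
  apply: le_trans (mu_setU_le (boundedD _ bY) bC).
  apply: le_mu; last by apply: boundedU => //; exact: boundedD.
  move=> p [Yp nI]; have [Xp|nX] := pselect (X p); [right|by left].
  by split => //; split; [exact: (hi t t1) Xp|exact: (hi' (1 - t) t1') Yp].
rewrite YX mu_setD//; [|exact: Jn_cmeas|].
  by rewrite m1 m2; ring.
by move=> p Ip; apply: (lo' (1 - t) t0'); rewrite setIC.
Qed.

Lemma mavg_spec A B s t : Jn A -> Jn B ->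
  [/\ Jn (mavg qs N eps t A B),
      mavg qs N eps 0 A B = B /\ mavg qs N eps 1 A B = A,
      dmu (mavg qs N eps s A B) (mavg qs N eps t A B) <= `|t - s| * dmu A B &
      (0 <= s <= 1 -> 0 <= t <= 1 ->
        [/\ mu (mavg qs N eps t A B) = t * mu A + (1 - t) * mu B,
            dmu (mavg qs N eps s A B) (mavg qs N eps t A B) = `|t - s| * dmu A B &
            ci (A `&` B) `<=` mavg qs N eps t A B /\
            mavg qs N eps t A B `<=` A `|` B])].
Proof.
move=> JA JB; split.
- exact: M_Jn.
- by split; [exact: M0|exact: M1].
- exact: M_submetric.
- by move=> s01 t01; split; [exact: M_mu|exact: M_metric|exact: M_bounds].
Qed.

End measure_average.


Unset Implicit Arguments.

Theorem mainTheorem8 (R : realType) (n : nat) (n_gt0 : (0 < n)%N)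
  (N eps : R) (N_ge1 : 1 <= N) (eps_gt0 : 0 < eps)
  (qs : set ('rV[R]_n) -> 'rV[R]_n) (qs_ok : centre_selector qs)
  (A B : set ('rV[R]_n)) (hA : Jn A) (hB : Jn B) (s t : R) :
  [/\ Jn (mavg qs N eps t A B),
      mavg qs N eps 0 A B = B /\ mavg qs N eps 1 A B = A,
      dmu (mavg qs N eps s A B) (mavg qs N eps t A B) <= `|t - s| * dmu A B &
      (0 <= s <= 1 -> 0 <= t <= 1 ->
        [/\ mu (mavg qs N eps t A B) = t * mu A + (1 - t) * mu B,
            dmu (mavg qs N eps s A B) (mavg qs N eps t A B) = `|t - s| * dmu A B &
            ci (A `&` B) `<=` mavg qs N eps t A B /\
            mavg qs N eps t A B `<=` A `|` B])].
Proof.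
(* The hypothesis [n_gt0] brings the dimension into the successor form of the sections above. *)
by case: n n_gt0 qs qs_ok A B hA hB => // n' _ qs qs_ok A B hA hB; exact: mavg_spec.
Qed.
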